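(* Let $\Omega\subseteq\mathbb{R}^n\times\mathbb{R}^p$ be an open definable set and let $F\colon\Omega\to\mathbb{R}^p$, $(x,y)\mapsto F(x,y)$, be a continuous definable mapping. Let $(\overline{x},\overline{y})\in\Omega$ be such that $F(\overline{x},\overline{y})=0$ and $$\lim_{r\to0^+}\ \inf_{A\in\mathrm{co}(dF_x(\mathbb{B}_r(\overline{y}))),\ x\in\mathbb{B}_r(\overline{x})}\sigma(A)>0,$$ where for each $x$ (near $\overline{x}$), $F_x$ stands for the mapping $y\mapsto F(x,y)$. Then there are open definable neighborhoods $U$ of $\overline{x}$ in $\mathbb{R}^n$ and $V$ of $\overline{y}$ in $\mathbb{R}^p$ and a unique continuous definable mapping $G\colon U\to V$ such that $G(\overline{x})=\overline{y}$ and $$F(x,G(x))=0\quad\text{for all } x\in U.$$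
   Context: Fix an o-minimal structure on $(\mathbb{R},+,\cdot)$, i.e. a sequence $(\mathcal{D}_n)_{n\in\mathbb{N}}$ such that: (a) $\mathcal{D}_n$ is a Boolean algebra of subsets of $\mathbb{R}^n$; (b) $X\in\mathcal{D}_m$, $Y\in\mathcal{D}_n$ imply $X\times Y\in\mathcal{D}_{m+n}$; (c) if $X\in\mathcal{D}_{n+1}$ then $\pi(X)\in\mathcal{D}_n$, where $\pi\colon\mathbb{R}^{n+1}\to\mathbb{R}^n$ is the projection on the first $n$ coordinates; (d) $\mathcal{D}_n$ contains all algebraic subsets of $\mathbb{R}^n$; (e) each set in $\mathcal{D}_1$ is a finite union of points and intervals. A set is definable if it belongs to some $\mathcal{D}_n$; a mapping is definable if its graph is definable. $\mathbb{B}_r(\cdot)$ denotes an open Euclidean ball of radius $r$ (in $\mathbb{R}^n$ or $\mathbb{R}^p$ according to its center); $\mathrm{co}$ denotes convex hull. For $A\in\mathbb{R}^{p\times p}$, $\sigma(A):=\inf_{\|v\|=1}\|Av\|$. For a continuous definable mapping $g$ from an open definable subset of $\mathbb{R}^p$ to $\mathbb{R}^p$, $B_g$ is the set of points of its domain at which $g$ is not of class $C^1$ (i.e. $g$ is not $C^1$ on any neighbourhood of the point), and for a subset $W$ of its domain, $dg(W):=\{dg(y): y\in W\setminus B_g\}$, where $dg(y)$ is the derivative of $g$ at $y$. This is applied with $g=F_x$, whose domain is $\{y\in\mathbb{R}^p:(x,y)\in\Omega\}$. The infimum in the limit condition is considered for $r>0$ small enough that $\mathbb{B}_r(\overline{x})\times\mathbb{B}_r(\overline{y})\subset\Omega$,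 and is taken over all pairs $(x,A)$ with $x\in\mathbb{B}_r(\overline{x})$ and $A\in\mathrm{co}(dF_x(\mathbb{B}_r(\overline{y})))$. *)

(* Defs.v *)
From HB Require Import structures.
From mathcomp Require Import all_boot all_order all_algebra.
From mathcomp Require Import all_classical all_reals all_analysis.
(* [mpoly] is required but not imported: its notations clash with those of
   MathComp-Analysis. [Import (canonicals) mpoly] makes only its instances
   available. *)
From mathcomp Require mpoly.
Import Order.TTheory GRing.Theory Num.Theory.
Import numFieldNormedType.Exports.

Set Implicit Arguments.
Unset Strict Implicit.
Unset Printing Implicit Defensive.

Local Open Scope classical_set_scope.
Local Open Scope ring_scope.

(* The space R^n is ['rV[R]_n], and R^m x R^n is identified with R^(m + n)
   through [concat]. *)
Definition concat (R : realType) (m n : nat) (z : 'rV[R]_m * 'rV[R]_n) :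
  'rV[R]_(m + n) := row_mx z.1 z.2.

Definition algebraic_set (R : realType) (n : nat) (X : set 'rV[R]_n) : Prop :=
  exists ps : seq (mpoly.mpoly n R),
    X = [set x | all (fun p => mpoly.meval (x ord0) p == 0) ps].

Record o_minimal_structure (R : realType) := OMinimalStructure {
  definable : forall n : nat, set 'rV[R]_n -> Prop ;
  definable_set0 : forall n, definable (set0 : set 'rV[R]_n) ;
  definable_setC : forall n (X : set 'rV[R]_n),
    definable X -> definable (~` X) ;
  definable_setU : forall n (X Y : set 'rV[R]_n),
    definable X -> definable Y -> definable (X `|` Y) ;
  definable_setX : forall m n (X : set 'rV[R]_m) (Y : set 'rV[R]_n),
    definable X -> definable Y -> definable (@concat R m n @` (X `*` Y)) ;
  definable_proj : forall n (X : set 'rV[R]_(n + 1)),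
    definable X -> definable ((lsubmx : _ -> 'rV[R]_n) @` X) ;
  definable_algebraic : forall n (X : set 'rV[R]_n),
    algebraic_set X -> definable X ;
  (* a point a is the degenerate interval [`[a, a]] *)
  definable_tame : forall X : set 'rV[R]_1, definable X ->
    exists s : seq (interval R),
      X = [set x | has (fun i : interval R => x ord0 ord0 \in i) s]
}.

(* Partial maps are represented by total functions together with a domain [A];
   values outside [A] are irrelevant. *)
Definition definable_map (R : realType) (D : o_minimal_structure R)
    (m p : nat) (A : set 'rV[R]_m) (f : 'rV[R]_m -> 'rV[R]_p) : Prop :=
  definable D [set concat (x, f x) | x in A].

Definition definable2 (R : realType) (D : o_minimal_structure R)
    (n p : nat) (A : set ('rV[R]_n * 'rV[R]_p)) : Prop :=
  definable D (@concat R n p @` A).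

Definition definable_map2 (R : realType) (D : o_minimal_structure R)
    (n p q : nat) (A : set ('rV[R]_n * 'rV[R]_p))
    (f : 'rV[R]_n * 'rV[R]_p -> 'rV[R]_q) : Prop :=
  definable D [set concat (concat z, f z) | z in A].

(* The library norm on ['rV[R]_n] is the sup norm. *)
Definition enorm (R : realType) (n : nat) (v : 'rV[R]_n) : R :=
  Num.sqrt (\sum_(i < n) v ord0 i ^+ 2).

Definition eball (R : realType) (n : nat) (a : 'rV[R]_n) (r : R) :
  set 'rV[R]_n := [set x | enorm (x - a) < r].

(* [v *m A^T] is the row vector of coordinates of A applied to the column [v].
   The infimum is taken in the extended reals, where inf of the empty set
   (which only occurs for p = 0) is +oo. *)
Definition sigma (R : realType) (p : nat) (A : 'M[R]_p) : \bar R :=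
  ereal_inf [set (enorm (v *m A^T))%:E | v in [set v | enorm v = 1]].

Definition convex_hull (R : realType) (p : nat) (S : set 'M[R]_p) :
  set 'M[R]_p := smallest (@convex_set R 'M[R]_p) S.

Definition C1_at (R : realType) (p : nat) (g : 'rV[R]_p -> 'rV[R]_p)
    (y : 'rV[R]_p) : Prop :=
  \forall z \near y, differentiable g z /\ {for z, continuous (jacobian g)}.

Definition nonC1 (R : realType) (p : nat) (g : 'rV[R]_p -> 'rV[R]_p) :
  set 'rV[R]_p := [set y | ~ C1_at g y].

(* [jacobian g y] acts on row vectors by right multiplication, so the usual
   matrix (d g_i / d y_j)_(i, j) is its transpose. *)
Definition derivatives (R : realType) (p : nat) (g : 'rV[R]_p -> 'rV[R]_p)
    (W : set 'rV[R]_p) : set 'M[R]_p :=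
  [set (jacobian g y)^T | y in W `\` nonC1 g].

Definition inf_sigma (R : realType) (n p : nat)
    (F : 'rV[R]_n * 'rV[R]_p -> 'rV[R]_p) (xbar : 'rV[R]_n) (ybar : 'rV[R]_p)
    (r : R) : \bar R :=
  ereal_inf [set sigma A | A in
    \bigcup_(x in eball xbar r)
      convex_hull (derivatives (fun y => F (x, y)) (eball ybar r))].

Definition implicit_map (R : realType) (D : o_minimal_structure R)
    (n p : nat) (F : 'rV[R]_n * 'rV[R]_p -> 'rV[R]_p)
    (xbar : 'rV[R]_n) (ybar : 'rV[R]_p)
    (U : set 'rV[R]_n) (V : set 'rV[R]_p) (G : 'rV[R]_n -> 'rV[R]_p) : Prop :=
  [/\ G @` U `<=` V,
      {within U, continuous G},
      definable_map D U G,
      G xbar = ybar &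
      forall x, U x -> F (x, G x) = 0].

(* Main.v *)
Require Import Defs.
From HB Require Import structures.
From mathcomp Require Import all_boot all_order all_algebra.
From mathcomp Require Import all_classical all_reals all_analysis.
From mathcomp Require Import ring lra.
From mathcomp Require mpoly.
Import (canonicals) mpoly.
Import Order.TTheory GRing.Theory Num.Theory.
Import numFieldNormedType.Exports.

Set Implicit Arguments.
Unset Strict Implicit.
Unset Printing Implicit Defensive.

Local Open Scope classical_set_scope.
Local Open Scope ring_scope.

(* For fixed [x], convexity turns the bound [sigma A >= c] on the convex hull
   into bounds [dot u (v *m A^T) >= k] valid for all the derivatives at once,
   with [v] given and [u] chosen, or with [u] given and [v] chosen.  Such a
   bound integrates to [dot u (F_x (y + t v) - F_x y) >= k t], because a
   definable continuous map is C1 on a dense open set: a segment violating the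
   bound yields an open set of points where it is violated infinitesimally.
   With [v] given, [F_x] is expanding, which gives uniqueness and the continuity
   of [G].  With [u] given, [v] is a direction of descent for [|F_x|] when
   [u = F_x y]; as [F_x] need not be Lipschitz, the minimum argument giving a
   zero of [F_x] is applied to averages of [F_x] over small cubes, which inherit
   the bounds.

   The facts needed from o-minimality follow from the tameness of germs on the
   line and from Baire's theorem: by induction on the dimension, every nonempty
   open set contains a nonempty open set that lies inside or outside a given
   definable set. *)

(** The bounds on the hull come from separation: for fixed [v] the vectors [v *m A^T], and for fixed
    [u] the vectors [u *m A], form a convex set that avoids a ball about 0, the second because a
    square matrix and its transpose have the same least singular value. The derivatives have no
    upper bound (a cube root is allowed), and this shapes the existence proof: a move by [t] against
    [v] changes the squared norm of [u = F_x y] by at most [- 2 c t |u|] plus the square of the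
    increment, and that square need not be small compared with [t]. For averages over cubes of side
    [e] the increment is of order [t / e], so a small [t] wins; the descent survives averaging
    because one [v] serves all base points. The averages are finite sums, so nothing has to be
    integrated; the price is a mesh, chosen after [e] and [t]. Baire's theorem acts through rational
    endpoints: it makes intervals that depend on a parameter uniform over an open set of parameters,
    where o-minimal geometry would usually choose the endpoints definably or cut the space into
    cells. *)

(** * Definable predicates and functions *)

(* A coding of [T] by row vectors, so that definability makes sense for subsets
   of products, whose factors play the role of the free variables. *)
Class chart (R : realType) (T : Type) := Chart {
  cdim : nat;
  decode : 'rV[R]_cdim -> T;
  encode : T -> 'rV[R]_cdim;
  encodeK : cancel encode decode;
  decodeK : cancel decode encode }.

#[global] Instance chart_rV (R : realType) n : chart R 'rV[R]_n :=
  @Chart R 'rV[R]_n n id id (fun=> erefl) (fun=> erefl).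

#[global] Program Instance chart_real (R : realType) : chart R R :=
  @Chart R R 1 (fun v => v ord0 ord0) const_mx _ _.
Next Obligation. by move=> R x; rewrite mxE. Qed.
Next Obligation. by move=> R v; apply/rowP => i; rewrite mxE !ord1. Qed.

#[global] Program Instance chart_prod (R : realType) T S
  (cT : chart R T) (cS : chart R S) : chart R (T * S) :=
  @Chart R (T * S) (@cdim R T cT + @cdim R S cS)
    (fun v => (decode (lsubmx v), decode (rsubmx v)))
    (fun z => row_mx (encode z.1) (encode z.2)) _ _.
Next Obligation.
by move=> R T S cT cS [x y] /=; rewrite row_mxKl row_mxKr !encodeK.
Qed.
Next Obligation.
by move=> R T S cT cS v /=; rewrite !decodeK hsubmxK.
Qed.

Section Definability.
Variables (R : realType) (D : o_minimal_structure R).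

Lemma definable_setT n : definable D (setT : set 'rV[R]_n).
Proof. by rewrite -setC0; apply/definable_setC/definable_set0. Qed.

Lemma definable_setI n (X Y : set 'rV[R]_n) :
  definable D X -> definable D Y -> definable D (X `&` Y).
Proof.
move=> dX dY; rewrite -[_ `&` _]setCK setCI.
by apply/definable_setC/definable_setU; apply: definable_setC.
Qed.

Lemma definable_forall_fin n (I : finType) (X : I -> set 'rV[R]_n) :
  (forall i, definable D (X i)) -> definable D [set x | forall i, X i x].
Proof.
move=> dX.
suff dS (s : seq I) : definable D [set x | forall i, i \in s -> X i x].
  rewrite (_ : mkset _ = [set x | forall i, i \in enum I -> X i x]) //.
  by apply/seteqP; split=> x /= Xx i => [_|]; apply: Xx; rewrite ?mem_enum.
elim: s => [|i s dS].
  rewrite (_ : mkset _ = setT); first exact: definable_setT.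
  by apply/seteqP; split=> x.
rewrite (_ : mkset _ = X i `&` [set x | forall j, j \in s -> X j x]).
  exact: definable_setI.
apply/seteqP; split=> x /=.
  move=> Xx; split; first by apply: Xx; rewrite mem_head.
  by move=> j js; apply: Xx; rewrite inE js orbT.
by move=> [Xix Xs] j; rewrite inE => /predU1P[->|/Xs].
Qed.

Lemma definable_cast n m (e : n = m) (X : set 'rV[R]_n) :
  definable D X -> definable D [set y : 'rV_m | X (castmx (erefl, esym e) y)].
Proof.
by case: m / e.
Qed.

(** Iterates the one-coordinate projection axiom; the casts only reassociate the dimension. *)
Lemma definable_lsubmx n m (X : set 'rV[R]_(n + m)) :
  definable D X -> definable D ((lsubmx : _ -> 'rV[R]_n) @` X).
Proof.
elim: m X => [|m IH] X dX.
  have := definable_cast (addn0 n) dX.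
  congr (definable D _); apply/seteqP; split=> y /=.
    move=> Xy; eexists; first exact: Xy.
    apply/rowP => i; rewrite mxE castmxE /=.
    by congr (y _ _); apply/val_inj.
  move=> [w Xw <-]; rewrite (_ : castmx _ _ = w) //.
  apply/rowP => i; rewrite castmxE /= mxE.
  by congr (w _ _); apply/val_inj.
have e : (n + m.+1 = n + m + 1)%N by rewrite addn1 addnS.
have /definable_proj/IH := definable_cast e dX.
congr (definable D _); apply/seteqP; split=> y /=.
  move=> [_ [w Xw <-] <-]; eexists; first exact: Xw.
  apply/rowP => i; rewrite !mxE castmxE /=.
  by congr (w _ _); apply/val_inj.
move=> [w Xw <-]; exists (lsubmx (castmx (erefl, e) w)); last first.
  apply/rowP => i; rewrite !mxE castmxE /=.
  by congr (w _ _); apply/val_inj.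
by exists (castmx (erefl, e) w) => //=; rewrite castmx_comp castmx_id.
Qed.

Lemma definable_poly_eq n (p : mpoly.mpoly n R) :
  definable D [set x : 'rV[R]_n | mpoly.meval (x ord0) p = 0].
Proof.
apply: definable_algebraic; exists [:: p].
by apply/seteqP; split=> x /=; rewrite andbT => /eqP.
Qed.

Let X_ n (i : 'I_n) : mpoly.mpoly n R := mpoly.mpolyX R (mpoly.mnm1 i).

Lemma definable_coord_eq n (i j : 'I_n) :
  definable D [set x : 'rV[R]_n | x ord0 i = x ord0 j].
Proof.
have := definable_poly_eq (X_ i - X_ j).
congr (definable D _); apply/seteqP; split=> x /=;
  rewrite mpoly.mevalB !mpoly.mevalXU.
  by move/eqP; rewrite subr_eq0 => /eqP.
by move=> ->; rewrite subrr.
Qed.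

Lemma definable_coord_cst n (i : 'I_n) c :
  definable D [set x : 'rV[R]_n | c = x ord0 i].
Proof.
have := definable_poly_eq (X_ i - mpoly.mpolyC n c).
congr (definable D _); apply/seteqP; split=> x /=;
  rewrite mpoly.mevalB mpoly.mevalXU mpoly.mevalC.
  by move/eqP; rewrite subr_eq0 => /eqP.
by move=> ->; rewrite subrr.
Qed.

Lemma definable_coord_add n (i j k : 'I_n) :
  definable D [set x : 'rV[R]_n | x ord0 i + x ord0 j = x ord0 k].
Proof.
have := definable_poly_eq (X_ i + X_ j - X_ k).
congr (definable D _); apply/seteqP; split=> x /=;
  rewrite mpoly.mevalB mpoly.mevalD !mpoly.mevalXU.
  by move/eqP; rewrite subr_eq0 => /eqP.
by move=> ->; rewrite subrr.
Qed.

Lemma definable_coord_mul n (i j k : 'I_n) :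
  definable D [set x : 'rV[R]_n | x ord0 i * x ord0 j = x ord0 k].
Proof.
have := definable_poly_eq (X_ i * X_ j - X_ k).
congr (definable D _); apply/seteqP; split=> x /=;
  rewrite mpoly.mevalB mpoly.mevalM !mpoly.mevalXU.
  by move/eqP; rewrite subr_eq0 => /eqP.
by move=> ->; rewrite subrr.
Qed.

(** The reindexing [s] may repeat or drop coordinates. The inverse image is the projection of that
    part of the product of the whole space with [X] where the last [m] coordinates agree with the
    selected ones. *)
Lemma definable_select n m (s : 'I_m -> 'I_n) (X : set 'rV[R]_m) :
  definable D X -> definable D [set x : 'rV[R]_n | X (\row_j x ord0 (s j))].
Proof.
move=> dX.
have dG : definable D [set w : 'rV[R]_(n + m) | forall j,
    w ord0 (rshift n j) = w ord0 (lshift m (s j))].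
  by apply: definable_forall_fin => j; apply: definable_coord_eq.
have := definable_lsubmx (definable_setI (definable_setX (definable_setT n) dX) dG).
congr (definable D _); apply/seteqP; split=> x /=.
  move=> [_ [[[u v] [_ /= Xv] <-] /= uv] <-].
  rewrite (_ : (\row_j _) = v) //; apply/rowP => j; rewrite mxE.
  rewrite /concat /= row_mxKl; have := uv j.
  by rewrite /concat row_mxEr row_mxEl.
move=> Xx; exists (row_mx x (\row_j x ord0 (s j))); last by rewrite row_mxKl.
split; first by exists (x, \row_j x ord0 (s j)).
by move=> j; rewrite row_mxEr row_mxEl mxE.
Qed.

Definition dpred T {cT : chart R T} (P : T -> Prop) : Prop :=
  definable D [set y | P (decode y)].

Definition dfun T S {cT : chart R T} {cS : chart R S} (f : T -> S) : Prop :=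
  dpred (fun z : T * S => f z.1 = z.2).

(** Maps that only rearrange, repeat or drop coordinates. Predicates are pulled back along them by
    [definable_select], before any closure under composition is known; they do the bookkeeping of
    variables. *)
Definition coord_map T S {cT : chart R T} {cS : chart R S} (f : T -> S) : Prop :=
  exists s : 'I_(@cdim R S cS) -> 'I_(@cdim R T cT), forall y,
    f (decode y) = decode (\row_j y ord0 (s j)).

Section Boolean.
Context {T : Type} {cT : chart R T}.

Lemma eq_dpred (P Q : T -> Prop) : (forall x, P x <-> Q x) -> dpred P -> dpred Q.
Proof. by move=> PQ; congr dpred; apply/funext => x; apply/propext. Qed.

Lemma dpred_set (X : set 'rV[R]_(@cdim R T cT)) :
  definable D X -> dpred (fun x : T => X (encode x)).
Proof.
congr (definable D _); apply/seteqP; split=> y /=; by rewrite decodeK.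
Qed.

Lemma dpred_cst (P : Prop) : dpred (fun _ : T => P).
Proof.
have [p|np] := pselect P.
  rewrite /dpred (_ : mkset _ = setT); first exact: definable_setT.
  by apply/seteqP; split.
rewrite /dpred (_ : mkset _ = set0); first exact: definable_set0.
by apply/seteqP; split.
Qed.

Lemma dpred_not (P : T -> Prop) : dpred P -> dpred (fun x => ~ P x).
Proof. exact: definable_setC. Qed.

Lemma dpred_or (P Q : T -> Prop) :
  dpred P -> dpred Q -> dpred (fun x => P x \/ Q x).
Proof. exact: definable_setU. Qed.

Lemma dpred_and (P Q : T -> Prop) :
  dpred P -> dpred Q -> dpred (fun x => P x /\ Q x).
Proof. exact: definable_setI. Qed.

Lemma dpred_imp (P Q : T -> Prop) :
  dpred P -> dpred Q -> dpred (fun x => P x -> Q x).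
Proof.
move=> dP dQ; apply: eq_dpred (dpred_or (dpred_not dP) dQ) => x.
by split=> [[nP /nP|]//|PQ]; have [/PQ|] := pselect (P x); [right|left].
Qed.

Lemma dpred_forall_fin (I : finType) (P : I -> T -> Prop) :
  (forall i, dpred (P i)) -> dpred (fun x => forall i, P i x).
Proof. exact: definable_forall_fin. Qed.

End Boolean.

Section Quantifiers.
Context {T S U : Type} {cT : chart R T} {cS : chart R S} {cU : chart R U}.

Lemma dpred_ex (P : T -> S -> Prop) :
  dpred (fun z : T * S => P z.1 z.2) -> dpred (fun x => exists y, P x y).
Proof.
move=> /definable_lsubmx; congr (definable D _).
apply/seteqP; split=> y /=.
  by move=> [w Pw <-]; exists (decode (rsubmx w)).
move=> [s Ps]; exists (row_mx y (encode s)); last by rewrite row_mxKl.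
by rewrite row_mxKl row_mxKr encodeK.
Qed.

Lemma dpred_forall (P : T -> S -> Prop) :
  dpred (fun z : T * S => P z.1 z.2) -> dpred (fun x => forall y, P x y).
Proof.
move=> dP.
have d : dpred (fun x => exists y, ~ P x y) by apply/dpred_ex/dpred_not.
apply: eq_dpred (dpred_not d) => x; split=> [nP y|P_ [y]//].
by apply: contrapT => nPy; apply: nP; exists y.
Qed.

Lemma dpred_pull (f : T -> S) (P : S -> Prop) :
  coord_map f -> dpred P -> dpred (fun x => P (f x)).
Proof.
move=> [s fs] /(definable_select s); congr (definable D _).
by apply/seteqP; split=> y /=; rewrite fs.
Qed.

Lemma coord_map_id : coord_map (@id T).
Proof.
by exists id => y; congr decode; apply/rowP => i; rewrite mxE.
Qed.

Lemma coord_map_fst (f : T -> S * U) : coord_map f -> coord_map (fun x => (f x).1).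
Proof.
move=> [s fs]; exists (s \o @lshift _ _) => y; rewrite fs /=.
by congr decode; apply/rowP => i; rewrite !mxE.
Qed.

Lemma coord_map_snd (f : T -> S * U) : coord_map f -> coord_map (fun x => (f x).2).
Proof.
move=> [s fs]; exists (s \o @rshift _ _) => y; rewrite fs /=.
by congr decode; apply/rowP => i; rewrite !mxE.
Qed.

Lemma coord_map_pair (f : T -> S) (g : T -> U) :
  coord_map f -> coord_map g -> coord_map (fun x => (f x, g x)).
Proof.
move=> [s fs] [t gt].
exists (fun i => match fintype.split i with inl j => s j | inr j => t j end) => y /=.
rewrite fs gt; congr pair; congr decode; apply/rowP => i; rewrite !mxE.
  case: fintype.splitP => [j /= ij|k /= ik].
    by congr (y _ (s _)); apply/val_inj.
  by have := ltn_ord i; rewrite ik ltnNge leq_addr.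
case: fintype.splitP => [j /= ij|k /= /addnI ik].
  by have := ltn_ord j; rewrite -ij ltnNge leq_addr.
by congr (y _ (t _)); apply/val_inj.
Qed.

End Quantifiers.

Section Functions.
Context {T S U : Type} {cT : chart R T} {cS : chart R S} {cU : chart R U}.

Lemma coord_map_coord n (f : T -> 'rV[R]_n) i :
  coord_map f -> coord_map (fun x => f x ord0 i).
Proof.
by move=> [s fs]; exists (fun=> s i) => y; rewrite fs /= !mxE.
Qed.

Lemma dpred_comp (f : T -> S) (P : S -> Prop) :
  dfun f -> dpred P -> dpred (fun x => P (f x)).
Proof.
move=> df dP.
have : dpred (fun x => exists y, f x = y /\ P y).
  apply/dpred_ex/dpred_and => //.
  by apply: dpred_pull dP; apply/coord_map_snd/coord_map_id.
by apply: eq_dpred => x; split=> [[y [-> //]]|Pfx]; exists (f x).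
Qed.

Lemma dpred_diag : dpred (fun z : S * S => z.1 = z.2).
Proof.
have := definable_forall_fin (fun i : 'I_(@cdim R S cS) =>
  definable_coord_eq (lshift _ i) (rshift _ i)).
congr (definable D _); apply/seteqP; split=> y /=.
  by move=> ey; congr decode; apply/rowP => i; rewrite !mxE.
by move=> /(can_inj decodeK)/rowP ey i; have := ey i; rewrite !mxE.
Qed.

Lemma dfun_coord_map (f : T -> S) : coord_map f -> dfun f.
Proof.
move=> cf; apply: (dpred_pull (f := fun z : T * S => (f z.1, z.2)) _ dpred_diag).
apply: coord_map_pair; last exact/coord_map_snd/coord_map_id.
have [s fs] := cf; exists (@lshift _ _ \o s) => y; rewrite fs /=.
by congr decode; apply/rowP => i; rewrite !mxE.
Qed.

Lemma dfun_comp (f : T -> S) (g : S -> U) :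
  dfun g -> dfun f -> dfun (fun x => g (f x)).
Proof.
move=> dg df.
have : dpred (fun z : T * U => exists y, f z.1 = y /\ g y = z.2).
  apply/dpred_ex/dpred_and.
    apply: (dpred_pull (f := fun z : T * U * S => (z.1.1, z.2)) _ df).
    apply: coord_map_pair; first by do 2 apply: coord_map_fst; apply: coord_map_id.
    exact/coord_map_snd/coord_map_id.
  apply: (dpred_pull (f := fun z : T * U * S => (z.2, z.1.2)) _ dg).
  apply: coord_map_pair; first exact/coord_map_snd/coord_map_id.
  exact/coord_map_snd/coord_map_fst/coord_map_id.
by apply: eq_dpred => z; split=> [[y [-> //]]|gf]; exists (f z.1).
Qed.

Lemma dfun_pair (f : T -> S) (g : T -> U) :
  dfun f -> dfun g -> dfun (fun x => (f x, g x)).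
Proof.
move=> df dg.
have : dpred (fun z : T * (S * U) => f z.1 = z.2.1 /\ g z.1 = z.2.2).
  apply: dpred_and.
    apply: (dpred_pull (f := fun z : T * (S * U) => (z.1, z.2.1)) _ df).
    apply: coord_map_pair; first exact/coord_map_fst/coord_map_id.
    exact/coord_map_fst/coord_map_snd/coord_map_id.
  apply: (dpred_pull (f := fun z : T * (S * U) => (z.1, z.2.2)) _ dg).
  apply: coord_map_pair; first exact/coord_map_fst/coord_map_id.
  exact/coord_map_snd/coord_map_snd/coord_map_id.
apply: eq_dpred => -[x [y z]] /=; split=> [[-> -> //]|[-> ->] //].
Qed.

Lemma dfun_cst (c : S) : dfun (fun _ : T => c).
Proof.
have := definable_forall_fin (fun i : 'I_(@cdim R S cS) =>
  definable_coord_cst (rshift (@cdim R T cT) i) (encode c ord0 i)).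
congr (definable D _); apply/seteqP; split=> y /=.
  move=> ey; apply: (can_inj encodeK); rewrite decodeK.
  by apply/rowP => i; rewrite ey mxE.
by move=> ->; rewrite decodeK => i; rewrite mxE.
Qed.

End Functions.

Section Arithmetic.
Context {T S U : Type} {cT : chart R T} {cS : chart R S} {cU : chart R U}.

Lemma dfun_id : dfun (@id T).
Proof. by apply: dfun_coord_map; apply: coord_map_id. Qed.

Lemma dfun_fst (f : T -> S * U) : dfun f -> dfun (fun x => (f x).1).
Proof.
move=> df; apply: (dfun_comp (g := fun z : S * U => z.1)) df.
by apply: dfun_coord_map; apply: coord_map_fst; apply: coord_map_id.
Qed.

Lemma dfun_snd (f : T -> S * U) : dfun f -> dfun (fun x => (f x).2).
Proof.
move=> df; apply: (dfun_comp (g := fun z : S * U => z.2)) df.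
by apply: dfun_coord_map; apply: coord_map_snd; apply: coord_map_id.
Qed.

Lemma dfun_coord n (f : T -> 'rV[R]_n) i :
  dfun f -> dfun (fun x => f x ord0 i).
Proof.
move=> df; apply: (dfun_comp (g := fun v : 'rV[R]_n => v ord0 i)) df.
by apply: dfun_coord_map; apply: coord_map_coord; apply: coord_map_id.
Qed.

Lemma dfun_add (f g : T -> R) : dfun f -> dfun g -> dfun (fun x => f x + g x).
Proof.
move=> df dg; apply: (dfun_comp (g := fun z : R * R => z.1 + z.2) _ (dfun_pair df dg)).
have := @definable_coord_add (1 + 1 + 1) (lshift 1 (lshift 1 ord0))
  (lshift 1 (rshift 1 ord0)) (rshift (1 + 1) ord0).
congr (definable D _); apply/seteqP; split=> y /=; by rewrite !mxE.
Qed.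

Lemma dfun_mul (f g : T -> R) : dfun f -> dfun g -> dfun (fun x => f x * g x).
Proof.
move=> df dg; apply: (dfun_comp (g := fun z : R * R => z.1 * z.2) _ (dfun_pair df dg)).
have := @definable_coord_mul (1 + 1 + 1) (lshift 1 (lshift 1 ord0))
  (lshift 1 (rshift 1 ord0)) (rshift (1 + 1) ord0).
congr (definable D _); apply/seteqP; split=> y /=; by rewrite !mxE.
Qed.

Lemma dfun_opp (f : T -> R) : dfun f -> dfun (fun x => - f x).
Proof.
move=> df; rewrite (_ : (fun x => - f x) = fun x => -1 * f x).
  exact/dfun_mul/df/dfun_cst.
by apply/funext => x; rewrite mulN1r.
Qed.

Lemma dpred_eq (f g : T -> S) : dfun f -> dfun g -> dpred (fun x => f x = g x).
Proof. by move=> df dg; apply: (dpred_comp (dfun_pair df dg) dpred_diag). Qed.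

End Arithmetic.

Section Order.
Context {T : Type} {cT : chart R T}.

(** The axioms provide equations only; positivity of [d] is the solvability of [t * t * d = 1]. *)
Lemma dpred_lt (f g : T -> R) : dfun f -> dfun g -> dpred (fun x => f x < g x).
Proof.
move=> df dg.
have : dpred (fun x => exists t : R, t * t * (g x + - f x) = 1).
  apply/dpred_ex/dpred_eq; last exact: dfun_cst.
  have dp : dfun (fun z : T * R => z.2) by apply/dfun_snd/dfun_id.
  apply: dfun_mul; first exact: dfun_mul.
  by apply: dfun_add; [|apply: dfun_opp];
    [apply: dfun_comp dg _|apply: dfun_comp df _]; apply/dfun_fst/dfun_id.
apply: eq_dpred => x; rewrite -subr_gt0; set d := g x - f x; split=> [[t td]|d0].
  have := @ltr01 R; rewrite -td; have [->|t0] := eqVneq t 0.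
    by rewrite !mul0r ltxx.
  by rewrite pmulr_rgt0 // -expr2 exprn_even_gt0.
exists (Num.sqrt d)^-1.
by rewrite -invfM -expr2 sqr_sqrtr ?ltW // mulVf // gt_eqF.
Qed.

Lemma dpred_le (f g : T -> R) : dfun f -> dfun g -> dpred (fun x => f x <= g x).
Proof.
move=> df dg; apply: eq_dpred (dpred_not (dpred_lt dg df)) => x.
by rewrite leNgt; split=> /negP.
Qed.

End Order.

Section Vectors.
Context {T : Type} {cT : chart R T}.

Lemma dfun_norm (f : T -> R) : dfun f -> dfun (fun x => `|f x|).
Proof.
move=> df; apply: (dfun_comp (g := fun z : R => `|z|)) df.
have d1 : dfun (fun z : R * R => z.1) by apply/dfun_fst/dfun_id.
have d2 : dfun (fun z : R * R => z.2) by apply/dfun_snd/dfun_id.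
have : dpred (fun z : R * R =>
    (0 <= z.1 /\ z.1 = z.2) \/ (z.1 < 0 /\ - z.1 = z.2)).
  apply: dpred_or; apply: dpred_and.
  - by apply: dpred_le => //; apply: dfun_cst.
  - exact: dpred_eq.
  - by apply: dpred_lt => //; apply: dfun_cst.
  - by apply: dpred_eq => //; apply: dfun_opp.
apply: eq_dpred => -[x y] /=; split=> [[[x0 <-]|[x0 <-]]|<-].
- exact: ger0_norm.
- exact: ltr0_norm.
- case: (ltP x 0) => x0; [right|left]; split => //.
    by rewrite ltr0_norm.
  by rewrite ger0_norm.
Qed.

Lemma dfun_row n (f : T -> 'rV[R]_n) :
  (forall i, dfun (fun x => f x ord0 i)) -> dfun f.
Proof.
move=> df.
have : dpred (fun z : T * 'rV[R]_n => forall i, f z.1 ord0 i = z.2 ord0 i).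
  apply: dpred_forall_fin => i; apply: dpred_eq.
    by apply: (dfun_comp (df i)); apply/dfun_fst/dfun_id.
  exact/dfun_coord/dfun_snd/dfun_id.
by apply: eq_dpred => z; split=> [/rowP|->].
Qed.

Lemma dfun_addv n (f g : T -> 'rV[R]_n) :
  dfun f -> dfun g -> dfun (fun x => f x + g x).
Proof.
move=> df dg; apply: dfun_row => i.
have := dfun_add (dfun_coord i df) (dfun_coord i dg); congr dfun.
by apply/funext => x; rewrite mxE.
Qed.

Lemma dfun_scale n (a : T -> R) (g : T -> 'rV[R]_n) :
  dfun a -> dfun g -> dfun (fun x => a x *: g x).
Proof.
move=> df dg; apply: dfun_row => i.
have := dfun_mul df (dfun_coord i dg); congr dfun.
by apply/funext => x; rewrite mxE.
Qed.

Lemma dfun_sum (I : Type) (r : seq I) (f : I -> T -> R) :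
  (forall i, dfun (f i)) -> dfun (fun x => \sum_(i <- r) f i x).
Proof.
move=> df; elim: r => [|i r IH].
  rewrite (_ : (fun _ => _) = fun=> 0); first exact: dfun_cst.
  by apply/funext => x; rewrite big_nil.
rewrite (_ : (fun _ => _) = fun x => f i x + \sum_(j <- r) f j x).
  exact: dfun_add.
by apply/funext => x; rewrite big_cons.
Qed.

End Vectors.
End Definability.

(* [tac] deals with the applications of functions known to be definable. *)
Ltac definability_with tac :=
  repeat first
  [ tac
  | match goal with
    | |- dpred _ (fun x => _ /\ _) => apply: dpred_and
    | |- dpred _ (fun x => _ \/ _) => apply: dpred_or
    | |- dpred _ (fun x => ~ _) => apply: dpred_not
    | |- dpred _ (fun x => exists y, _) => apply: dpred_ex
    | |- dpred _ (fun x => _ -> _) => apply: dpred_imp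
    | |- dpred _ (fun x => forall y : ordinal _, _) => apply: dpred_forall_fin => ?
    | |- dpred _ (fun x => forall y, _) => apply: dpred_forall
    | |- dpred _ (fun x => is_true (_ < _)) => apply: dpred_lt
    | |- dpred _ (fun x => is_true (_ <= _)) => apply: dpred_le
    | |- dpred _ (fun x => _ = _) => apply: dpred_eq
    | |- dfun _ (fun x => x) => exact: dfun_id
    | |- dfun _ fst => apply: (dfun_fst (f := id)); exact: dfun_id
    | |- dfun _ snd => apply: (dfun_snd (f := id)); exact: dfun_id
    | |- dfun _ (fun x => ?c) => exact: dfun_cst
    | |- dfun _ (fun x => (_, _)) => apply: dfun_pair
    | |- dfun _ (fun x => _.1) => apply: dfun_fst
    | |- dfun _ (fun x => _.2) => apply: dfun_snd
    | |- dfun _ (fun x => (_ + _ : 'rV_ _)) => apply: dfun_addv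
    | |- dfun _ (fun x => _ *: _) => apply: dfun_scale
    | |- dfun _ (fun x => _ + _) => apply: dfun_add
    | |- dfun _ (fun x => - _) => apply: dfun_opp
    | |- dfun _ (fun x => _ * _) => apply: dfun_mul
    | |- dfun _ (fun x => `| _ |) => apply: dfun_norm
    | |- dfun _ (fun x => fun_of_matrix _ ord0 _) => apply: dfun_coord
    end
  | assumption
  | match goal with
    | |- dfun _ (GRing.add ?a) => change (GRing.add a) with (fun x => a + x)
    | |- dfun _ (GRing.mul ?a) => change (GRing.mul a) with (fun x => a * x)
    end ].
Ltac definability := definability_with fail.

(** * Germs of definable sets of the line *)

(** Written with quantifiers over the reals instead of a filter, so that it is a formula and
    [dpred_germ] applies. *)
Definition germ (R : realType) (P : R -> Prop) : Prop :=
  exists e : R, 0 < e /\ forall h, 0 < h -> h < e -> P h.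

Definition right_derivative (R : realType) (f : R -> R) (s L : R) : Prop :=
  forall e, 0 < e -> germ (fun h => `|f (s + h) - f s - h * L| <= e * h).

Section Germs.
Variable R : realType.
Implicit Types P Q : R -> Prop.

Lemma germ_and P Q : germ P -> germ Q -> germ (fun h => P h /\ Q h).
Proof.
move=> [d [d0 Pd]] [e [e0 Qe]]; exists (Num.min d e); rewrite lt_min d0 e0.
by split=> // h h0; rewrite lt_min => /andP[hd he]; split; [exact: Pd|exact: Qe].
Qed.

Lemma germ_imp P Q : (forall h, 0 < h -> P h -> Q h) -> germ P -> germ Q.
Proof.
move=> PQ [d [d0 Pd]]; exists d; split=> // h h0 hd.
by apply: PQ => //; apply: Pd.
Qed.

Lemma germ_lt (e : R) : 0 < e -> germ (fun h => h < e).
Proof. by move=> e0; exists e. Qed.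

Lemma germ_ex P : germ P -> exists2 h, 0 < h & P h.
Proof.
move=> [d [d0 Pd]]; exists (d / 2); first by lra.
by apply: Pd; lra.
Qed.

Let decided P := germ P \/ germ (fun h => ~ P h).

Let decided_or P Q : decided P -> decided Q -> decided (fun h => P h \/ Q h).
Proof.
move=> [gP|gP] [gQ|gQ]; try by [left; apply: germ_imp gP => ? ? ?; left];
  try by [left; apply: germ_imp gQ => ? ? ?; right].
by right; apply: germ_imp (germ_and gP gQ) => h _ [nP nQ] [].
Qed.

Let decided_and P Q : decided P -> decided Q -> decided (fun h => P h /\ Q h).
Proof.
move=> [gP|gP]; last by right; apply: germ_imp gP => ? ? nP [].
move=> [gQ|gQ]; last by right; apply: germ_imp gQ => ? ? nQ [].
by left; apply: germ_and.
Qed.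

Let decided_itv (i : interval R) : decided (fun h => h \in i).
Proof.
case: i => l u.
suff [dl du] : decided (fun h => (l <= BLeft h)%O) /\
    decided (fun h => (BRight h <= u)%O).
  have E h : (h \in Interval l u) <-> (l <= BLeft h)%O /\ (BRight h <= u)%O.
    by rewrite itv_boundlr; split=> /andP.
  by have [g|g] := decided_and dl du; [left|right];
    apply: germ_imp g => h _; rewrite E.
split.
  case: l => [b l|[]].
  - case: (lerP l 0) => l0; [left|right].
      exists 1; split=> // h h0 _; case: b; rewrite bnd_simp; lra.
    exists l; split=> // h h0 hl; case: b; rewrite bnd_simp; apply/negP;
      rewrite -?ltNge -?leNgt; lra.
  - by left; exists 1.
  - by right; exists 1.
case: u => [b u|[]].
- case: (ltrP 0 u) => u0; [left|right].
    exists u; split=> // h h0 hu; case: b; rewrite bnd_simp; lra.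
  exists 1; split=> // h h0 _; case: b; rewrite bnd_simp; apply/negP;
    rewrite -?ltNge -?leNgt; lra.
- by right; exists 1.
- by left; exists 1.
Qed.

(** An interval contains or misses a right neighbourhood of 0, and this dichotomy passes to finite
    unions. The tameness axiom enters the development here and nowhere else; at another point [s]
    the lemma is applied to [h |-> P (s + h)]. *)
Lemma germ_decided (D : o_minimal_structure R) P :
  dpred D P -> germ P \/ germ (fun h => ~ P h).
Proof.
move=> /definable_tame [s Ps].
have {}Ps h : P h <-> has (fun i : interval R => h \in i) s.
  have := congr1 (fun X : set 'rV[R]_1 => X (const_mx h)) Ps.
  by rewrite /= !mxE => ->.
have : decided (fun h => has (fun i : interval R => h \in i) s).
  elim: s {Ps} => [|i s IH]; first by right; exists 1.
  have [g|g] := decided_or (decided_itv i) IH; [left|right];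
    by apply: germ_imp g => h _ /=; rewrite (rwP orP).
by move=> [g|g]; [left|right]; apply: germ_imp g => h _; rewrite Ps.
Qed.

Lemma dpred_germ (D : o_minimal_structure R) T (cT : chart R T)
    (P : T -> R -> Prop) :
  dpred D (fun z : T * R => P z.1 z.2) -> dpred D (fun x => germ (P x)).
Proof.
move=> dP; rewrite /germ; definability.
by apply: (dpred_comp (f := fun z : T * R * R => (z.1.1, z.2))) dP; definability.
Qed.

(* The infimum of the points where [f] is below [f a] would be a point [c] with
   [f a <= f c], and the germ at [c] leaves no such points just after [c]. *)
Lemma right_nondecreasing (f : R -> R) (a b : R) : a <= b ->
  (forall s, a <= s <= b -> {for s, continuous f}) ->
  (forall s, a <= s < b -> germ (fun h => f s <= f (s + h))) -> f a <= f b.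
Proof.
move=> ab cf gf; rewrite leNgt; apply/negP => fba.
pose B := [set s | a <= s <= b /\ f s < f a].
have Bb : B b by split=> //; rewrite ab lexx.
have lbB : lbound B a by move=> s [/andP[]].
have iB : has_inf B by split; [exists b|exists a].
set c := inf B.
have ac : a <= c by apply: lb_le_inf => //; exists b.
have cb : c <= b by apply: (ge_inf iB.2).
have Blow s : a <= s -> s < c -> f a <= f s.
  move=> las sc; rewrite leNgt; apply/negP => fs.
  have : B s by split=> //; rewrite las (le_trans (ltW sc) cb).
  by move/(ge_inf iB.2); rewrite leNgt sc.
have fac : f a <= f c.
  rewrite leNgt; apply/negP => fca.
  have a_c : a < c by rewrite lt_neqAle ac andbT; apply/eqP => E; rewrite -E ltxx in fca.
  have : f a - f c > 0 by rewrite subr_gt0.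
  have /cvgrPdist_lt/[apply] := cf c (introT andP (conj ac cb)).
  move=> /nbhs_ballP[e /= e0 He].
  pose s := Num.max a (c - e / 2).
  have sc : s < c by rewrite gt_max a_c /=; lra.
  have sa : a <= s by rewrite le_max lexx.
  have se : c - e / 2 <= s by rewrite le_max lexx orbT.
  have /He : ball c e s by rewrite -ball_normE /ball_ /= ger0_norm; lra.
  have := Blow s sa sc; rewrite ltr_norml => fas /andP[]; lra.
have c_b : c < b.
  rewrite lt_neqAle cb andbT; apply/eqP => E.
  by move: fba; rewrite -E ltNge fac.
have [|e [e0 He]] := gf c; first by rewrite ac.
have [s [/andP[sa sb] fs] se] := inf_adherent e0 iB.
have cs : c <= s by apply: (ge_inf iB.2); split=> //; rewrite sa.
move: cs; rewrite le_eqVlt => /predU1P[E|cs]; first by move: fs; rewrite -E ltNge fac.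
have := He (s - c); rewrite subrKC subr_gt0 ltrBlDl => /(_ cs se) fcs.
by have := lt_le_trans fs fac; rewrite ltNge fcs.
Qed.

Lemma right_slope_ge (f : R -> R) (a b K : R) : a <= b ->
  (forall s, a <= s <= b -> {for s, continuous f}) ->
  (forall s, a <= s < b -> germ (fun h => f s + K * h <= f (s + h))) ->
  f a + K * (b - a) <= f b.
Proof.
move=> ab cf gf.
suff : f a - K * a <= f b - K * b by lra.
apply: (@right_nondecreasing (fun s => f s - K * s)) => // s sab.
  apply: cvgB; first exact: cf.
  by apply: cvgMr; apply: cvg_id.
by apply: germ_imp (gf s sab) => h h0; lra.
Qed.

Lemma right_slope_le (f : R -> R) (a b K : R) : a <= b ->
  (forall s, a <= s <= b -> {for s, continuous f}) ->
  (forall s, a <= s < b -> germ (fun h => f (s + h) <= f s + K * h)) ->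
  f b <= f a + K * (b - a).
Proof.
move=> ab cf gf.
suff : - f a + (- K) * (b - a) <= - f b by lra.
apply: (@right_slope_ge (fun s => - f s)) => // s sab.
  by apply: cvgN; exact: cf.
by apply: germ_imp (gf s sab) => h h0; lra.
Qed.

(** If the set [N] of points of decrease contained no interval, tameness would make it miss an
    interval just after each [s]. There [f] would be nondecreasing, by continuity from [s] on, so
    [s] itself would not be in [N]; with [N] empty, [right_nondecreasing] contradicts
    [f b < f a]. *)
Lemma decreasing_germs_on_interval (D : o_minimal_structure R) (f : R -> R) (a b : R) :
  dfun D f -> a < b -> (forall s, a <= s <= b -> {for s, continuous f}) ->
  f b < f a ->
  exists c d, [/\ a <= c, c < d, d <= b &
    forall s, c < s -> s < d -> germ (fun h => f (s + h) < f s)].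
Proof.
move=> df ab cf fba; apply: contrapT => noN.
pose N s := germ (fun h => f (s + h) < f s).
have dN s : N s \/ germ (fun h => f s <= f (s + h)).
  have [|g|g] := @germ_decided D (fun h => f (s + h) < f s).
  - by definability_with ltac:(apply: (dfun_comp df)).
  - by left.
  - by right; apply: germ_imp g => h _ /negP; rewrite -leNgt.
have dpN : dpred D N.
  by apply: dpred_germ; definability_with ltac:(apply: (dfun_comp df)).
have N' s : a <= s < b -> germ (fun h => f s <= f (s + h)).
  move=> /andP[sa sb].
  have [|[e [e0 He]]|[e [e0 He]]] := @germ_decided D (fun h => N (s + h)).
  - by apply: (dpred_comp (f := fun h => s + h)) dpN; definability.
  - exfalso; apply: noN; exists s, (Num.min (s + e) b); split=> //.
    + by rewrite lt_min sb andbT; lra.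
    + by rewrite ge_min lexx orbT.
    + move=> t st; rewrite lt_min => /andP[te tb].
      by have := He (t - s); rewrite subrKC; apply; lra.
  exists (Num.min e (b - s)); split; first by rewrite lt_min e0 /=; lra.
  move=> h h0; rewrite lt_min => /andP[he hb].
  have mono t : s < t -> t <= s + h -> f t <= f (s + h).
    move=> st th; apply: right_nondecreasing => // u /andP[ut uh].
      by apply: cf; lra.
    have [Nu|//] := dN u.
    by have := He (u - s); rewrite subrKC; case; [lra|lra|].
  rewrite leNgt; apply/negP => fsh.
  have : f s - f (s + h) > 0 by rewrite subr_gt0.
  have /cvgrPdist_lt/[apply] : {for s, continuous f} by apply: cf; lra.
  move=> /nbhs_ballP[d /= d0 Hd].
  pose t := s + Num.min (d / 2) h.
  have m0 : 0 < Num.min (d / 2) h by rewrite lt_min h0 andbT; lra.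
  have mh : Num.min (d / 2) h <= h by rewrite ge_min lexx orbT.
  have md : Num.min (d / 2) h <= d / 2 by rewrite ge_min lexx.
  have /Hd : ball s d t.
    by rewrite -ball_normE /ball_ /= /t ltr_norml; lra.
  have := mono t; rewrite /t ltr_norml => /(_ ltac:(lra) ltac:(lra)) ft /andP[]; lra.
by have := right_nondecreasing (ltW ab) cf N'; rewrite leNgt fba.
Qed.

Lemma unbounded_slope_false (f : R -> R) (a b : R) : a < b ->
  (forall s, a <= s <= b -> {for s, continuous f}) ->
  (forall s, a <= s < b -> forall K, germ (fun h => f s + K * h <= f (s + h))) ->
  False.
Proof.
move=> ab cf gf.
pose K := (f b - f a) / (b - a) + 1.
have := @right_slope_ge f a b K (ltW ab) cf (fun s sab => gf s sab K).
by rewrite /K mulrDl divfK ?subr_eq0 ?gt_eqF //; lra.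
Qed.

(** By tameness the right difference quotient at each [s] compares with every constant [K], so it
    has a limit, possibly infinite. If no limit were finite, tameness would fix the sign of the
    infinity on an interval after the midpoint [m], which [unbounded_slope_false] excludes. *)
Lemma right_derivative_exists (D : o_minimal_structure R) (f : R -> R) (a b : R) :
  dfun D f -> a < b -> (forall s, a < s < b -> {for s, continuous f}) ->
  exists2 s, a < s < b & exists L, right_derivative f s L.
Proof.
move=> df ab cf; apply: contrapT => noL.
pose up s := forall K : R, germ (fun h => f s + K * h <= f (s + h)).
have dup : dpred D up.
  apply: dpred_forall.
  apply: (dpred_germ (P := fun (z : R * R) h => f z.1 + z.2 * h <= f (z.1 + h))).
  by definability_with ltac:(apply: (dfun_comp df)).
have gd s K : germ (fun h => f s + K * h <= f (s + h)) \/
    germ (fun h => f (s + h) < f s + K * h).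
  have [|g|g] := @germ_decided D (fun h => f s + K * h <= f (s + h)).
  - by definability_with ltac:(apply: (dfun_comp df)).
  - by left.
  - by right; apply: germ_imp g => h _ /negP; rewrite -ltNge.
have down s : a < s < b -> ~ up s ->
    forall K, germ (fun h => f (s + h) <= f s + K * h).
  move=> sab nup K; have [g|g] := gd s K; last first.
    by apply: germ_imp g => h _ /ltW.
  exfalso; apply: noL; exists s => //.
  pose S := [set K | germ (fun h => f s + K * h <= f (s + h))].
  have [K1 gK1] : exists K1, germ (fun h => f (s + h) < f s + K1 * h).
    apply: contrapT => nK; apply: nup => K'; have [//|g'] := gd s K'.
    by exfalso; apply: nK; exists K'.
  have ubS : ubound S K1.
    move=> K' gK'; rewrite leNgt; apply/negP => K1K.
    have [h h0 [h1 h2]] := germ_ex (germ_and gK1 gK').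
    have := ltr_pM2r h0 K1 K'; rewrite K1K; lra.
  have sS : has_sup S by split; [exists K|exists K1].
  (* The derivative is the supremum of the slopes of lines through the graph at [s] that stay below
     it just after [s]. *)
  exists (sup S) => e e0.
  have [K2 gK2 K2S] := sup_adherent e0 sS.
  have [g3|g3] := gd s (sup S + e).
    by have := ub_le_sup sS.2 g3; rewrite gerDl leNgt e0.
  apply: germ_imp (germ_and gK2 g3) => h h0 [h2 h3].
  have := ltr_pM2r h0 (sup S - e) K2; rewrite K2S.
  rewrite ler_norml; lra.
pose m := (a + b) / 2.
have cf' u v : a < u -> v < b -> forall s, u <= s <= v -> {for s, continuous f}.
  by move=> ? ? s sab; apply: cf; lra.
have [|[e [e0 He]]|[e [e0 He]]] := @germ_decided D (fun h => up (m + h)).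
- by apply: (dpred_comp (f := fun h => m + h)) dup; definability.
- pose d := Num.min e (b - m).
  have d0 : 0 < d by rewrite lt_min e0 /= /m; lra.
  have [de db] : d <= e /\ d <= b - m by rewrite !ge_min !lexx orbT.
  apply: (@unbounded_slope_false f (m + d / 4) (m + d / 2)).
  + by lra.
  + by apply: cf'; rewrite /m in db *; lra.
  + move=> s sab K; have := He (s - m); rewrite subrKC; apply; lra.
- pose d := Num.min e (b - m).
  have d0 : 0 < d by rewrite lt_min e0 /= /m; lra.
  have [de db] : d <= e /\ d <= b - m by rewrite !ge_min !lexx orbT.
  apply: (@unbounded_slope_false (fun s => - f s) (m + d / 4) (m + d / 2)).
  + by lra.
  + move=> s sab; apply: cvgN; apply: cf' sab; rewrite /m in db *; lra.
  + move=> s sab K.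
    apply: germ_imp (down s _ _ (- K)) => [h h0||].
    * lra.
    * by rewrite /m in db sab *; lra.
    * by have := He (s - m); rewrite subrKC; apply; lra.
Qed.

End Germs.

(** * Definable sets and Baire's theorem *)

(* Joins completeness and the norm on matrices, for [Baire]. *)
HB.instance Definition _ (R : realType) (m n : nat) :=
  NormedModule.on 'M[R]_(m, n).

(** For [O] open: the interior of [P] is dense in [O]. Unlike mere density this is stable under
    finite intersections. *)
Definition generic (T : topologicalType) (O P : set T) : Prop :=
  forall W, open W -> W !=set0 -> W `<=` O ->
    exists W', [/\ open W', W' !=set0, W' `<=` W & W' `<=` P].

(** Equivalent to the boundary of [X] having empty interior. *)
Definition locally_decided (T : topologicalType) (X : set T) : Prop :=
  forall W, open W -> W !=set0 ->
    exists W', [/\ open W', W' !=set0, W' `<=` W & W' `<=` X \/ W' `<=` ~` X].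

Section Generic.
Variables (R : realType).

Lemma continuous_atP (V W : normedModType R) (f : V -> W) z :
  {for z, continuous f} <-> forall e : R, 0 < e ->
    exists2 d : R, 0 < d & forall z', `|z - z'| < d -> `|f z - f z'| < e.
Proof.
split=> [/cvgrPdist_lt cf e e0|cf].
  have /nbhs_ballP[d /= d0 Hd] := cf e e0; exists d => // z' zz'.
  by apply: Hd; rewrite -ball_normE.
apply/cvgrPdist_lt => e e0; have [d d0 Hd] := cf e e0.
by apply/nbhs_ballP; exists d => //= z'; rewrite -ball_normE; apply: Hd.
Qed.

Lemma ball_rV n (x y : 'rV[R]_n) (e : R) : 0 < e ->
  (forall i, `|x ord0 i - y ord0 i| < e) <-> ball x e y.
Proof.
move=> e0; split=> [xy|[_ xy] i].
  by split=> // i j; rewrite ord1 -ball_normE; apply: xy.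
by have := xy ord0 i; rewrite -ball_normE.
Qed.

Lemma generic_and (T : topologicalType) (O P Q : set T) :
  generic O P -> generic O Q -> generic O (P `&` Q).
Proof.
move=> gP gQ W oW W0 WO; have [W1 [oW1 W10 W1W W1P]] := gP W oW W0 WO.
have [W2 [oW2 W20 W2W W2Q]] := gQ W1 oW1 W10 (subset_trans W1W WO).
exists W2; split=> //; first exact: subset_trans W1W.
by move=> x W2x; split; [apply/W1P/W2W|apply: W2Q].
Qed.

Lemma generic_forall_fin (T : topologicalType) (I : finType) (O : set T)
    (P : I -> set T) :
  (forall i, generic O (P i)) -> generic O [set x | forall i, P i x].
Proof.
move=> gP.
suff gs (s : seq I) : generic O [set x | forall i, i \in s -> P i x].
  move=> W oW W0 WO; have [W' [oW' W'0 W'W W'P]] := gs (enum I) W oW W0 WO.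
  by exists W'; split=> // x /W'P Px i; apply: Px; rewrite mem_enum.
elim: s => [|i s IH]; first by move=> W oW W0 WO; exists W; split.
move=> W oW W0 WO; have [W' [oW' W'0 W'W W'P]] := generic_and (gP i) IH oW W0 WO.
exists W'; split=> // x /W'P [Pix Px] j.
by rewrite inE => /predU1P[->//|]; apply: Px.
Qed.

(* By Baire, since the interior of [~` A k] is dense unless [A k] contains a
   nonempty open set. *)
Lemma baire_cover n (J : countType) (A : J -> set 'rV[R]_n) (W : set 'rV[R]_n) :
  open W -> W !=set0 -> (forall x, W x -> exists i, A i x) ->
  (forall i, locally_decided (A i)) ->
  exists i W', [/\ open W', W' !=set0, W' `<=` W & W' `<=` A i].
Proof.
move=> oW W0 WA gA; apply: contrapT => noW'.
(* The index set is enumerated by [unpickle], numbers that code nothing giving the whole space.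
   Intersecting [A i] with [W] makes the complement trivially dense off [W]. *)
pose O (k : nat) : set 'rV[R]_n :=
  if unpickle k is Some i then interior (~` (A i `&` W)) else setT.
have oO k : open (O k) /\ dense (O k).
  rewrite /O; case: (unpickle k) => [i|]; last first.
    by split; [exact: openT|move=> V V0 _; rewrite setIT].
  split; first exact: open_interior.
  move=> V V0 oV.
  have [VW0|VW] := pselect ((V `&` W) !=set0); last first.
    have [x Vx] := V0; exists x; split=> //.
    apply: (filterS _ (open_nbhs_nbhs (conj oV Vx))) => y Vy [_ Wy].
    by apply: VW; exists y.
  have oVW : open (V `&` W) by apply: openI.
  have [W' [oW' W'0 W'W [W'A|W'A]]] := gA i _ oVW VW0.
    by exfalso; apply: noW'; exists i, W'; split=> // x /W'W [].
  have [x W'x] := W'0; exists x; split; first by have [] := W'W _ W'x.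
  by apply: (filterS _ (open_nbhs_nbhs (conj oW' W'x))) => y /W'A nAy [].
have [x [Wx Ox]] := Baire oO W0 oW.
have [i Aix] := WA x Wx.
have := Ox (pickle i) I.
by rewrite /O pickleK => /interior_subset; apply; split.
Qed.

Lemma open_box n (W : set 'rV[R]_(1 + n)) : open W -> W !=set0 ->
  exists a b (V : set 'rV[R]_n), [/\ a < b, open V, V !=set0 &
    forall t y, a < t -> t < b -> V y -> W (row_mx (const_mx t) y)].
Proof.
move=> oW [w Ww].
have /nbhs_ballP[e /= e0 He] := open_nbhs_nbhs (conj oW Ww).
pose w0 := w ord0 (lshift n ord0).
exists (w0 - e), (w0 + e), (ball (rsubmx w) e); split.
- lra.
- exact: ball_open.
- by exists (rsubmx w); apply: ballxx.
move=> t y t1 t2 wy; apply: He; apply/ball_rV => // i; rewrite mxE.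
case: fintype.splitP => j ij.
  rewrite (_ : i = lshift n ord0) ?mxE; last by apply/val_inj; rewrite /= ij ord1.
  by rewrite ltr_norml -/w0; lra.
have /ball_rV := wy => /(_ e0 j); rewrite mxE; congr (`|w _ _ - _| < _).
exact/val_inj.
Qed.

Lemma box_open n (a b : R) (V : set 'rV[R]_n) : open V ->
  open [set w : 'rV[R]_(1 + n) |
    [/\ a < w ord0 (lshift n ord0), w ord0 (lshift n ord0) < b & V (rsubmx w)]].
Proof.
move=> oV; rewrite openE => w [wa wb Vw].
have /nbhs_ballP[e /= e0 He] := open_nbhs_nbhs (conj oV Vw).
set w0 := w _ _ in wa wb.
pose d := Num.min e (Num.min (w0 - a) (b - w0)).
have d0 : 0 < d by rewrite !lt_min e0 !subr_gt0 wa wb.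
have [de [da db]] : d <= e /\ d <= w0 - a /\ d <= b - w0.
  by rewrite /d !ge_min !lexx !orbT.
apply/nbhs_ballP; exists d => //= v /ball_rV => /(_ d0) vw.
have := vw (lshift n ord0); rewrite ltr_norml -/w0 => /andP[v1 v2].
split; [lra|lra|apply: He; apply/ball_rV => // i; rewrite !mxE].
exact: lt_le_trans (vw _) de.
Qed.

Variable D : o_minimal_structure R.

(** A fibre that contains an interval contains one with rational endpoints, so countably many
    definable sets [A q] cover [V], and Baire's theorem yields one pair of endpoints valid over an
    open set. Decidedness in dimension [n] is a hypothesis because the lemma serves inside the
    induction of [definable_locally_decided]. *)
Lemma interval_fibers_of_decided n :
  (forall X : set 'rV[R]_n, definable D X -> locally_decided X) ->
  forall (E : R * 'rV[R]_n -> Prop) (V : set 'rV[R]_n),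
  dpred D E -> open V -> V !=set0 ->
  (forall y, V y -> exists a b, a < b /\ forall t, a < t -> t < b -> E (t, y)) ->
  exists a b V', [/\ a < b, open V', V' !=set0, V' `<=` V &
    forall t y, a < t -> t < b -> V' y -> E (t, y)].
Proof.
move=> decn E V dE oV V0 fib.
pose A (q : rat * rat) := [set y : 'rV[R]_n | ratr q.1 < ratr q.2 :> R /\
  forall t : R, ratr q.1 < t -> t < ratr q.2 -> E (t, y)].
have [|q|q [W [oW W0 WV WA]]] := @baire_cover n _ A V oV V0.
- move=> y /fib [a [b [ab Eab]]].
  have [q1 /andP[q1a q1b]] := rat_in_itvoo ab.
  have [q2 /andP[q2a q2b]] := rat_in_itvoo q1b.
  rewrite !bnd_simp in q1a q1b q2a q2b.
  exists (q1, q2); split=> //= t t1 t2; apply: Eab.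
    exact: lt_trans t1.
  exact: lt_trans t2 q2b.
- apply: decn.
  have dA : dpred D (fun y : 'rV[R]_n => ratr q.1 < ratr q.2 :> R /\
    forall t : R, ratr q.1 < t -> t < ratr q.2 -> E (t, y)).
    apply: dpred_and; first exact: dpred_cst.
    definability.
    by apply: (dpred_comp (f := fun z : 'rV[R]_n * R => (z.2, z.1))) dE; definability.
  exact: dA.
have [y Wy] := W0.
by exists (ratr q.1), (ratr q.2), W; split=> //;
  [have [] := WA y Wy|move=> t z t1 t2 /WA [_]; apply].
Qed.

(** Inside a box []a, b[ x V], whether the fibre of [X] over [y] contains an interval is a definable
    condition on [y], hence decided on some open [V']; [interval_fibers_of_decided] then makes the
    interval uniform, for [X] or for its complement. *)
Lemma definable_locally_decided n (X : set 'rV[R]_n) :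
  definable D X -> locally_decided X.
Proof.
elim: n X => [|n IH] X dX W oW W0.
  have [w Ww] := W0; exists W; split=> //.
  have [Xw|nXw] := pselect (X w); [left|right] => v _.
    by rewrite (_ : v = w) //; apply/rowP => -[].
  by rewrite (_ : v = w) //; apply/rowP => -[].
have [a [b [V [ab oV V0 VW]]]] := open_box oW W0.
pose row (z : R * 'rV[R]_n) : 'rV[R]_(1 + n) := row_mx (const_mx z.1) z.2.
have dXr : dpred D (fun z : R * 'rV[R]_n => X (row z)) 
  by exact: (@dpred_set R D (R * 'rV[R]_n)%type _ X dX).
pose E Y (z : R * 'rV[R]_n) := (a < z.1 /\ z.1 < b) /\ Y (row z).
have dEX : dpred D (E X) by rewrite /E; definability.
have dEnX : dpred D (E (~` X)).
  by rewrite /E /setC /=; definability.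
pose fib Y y := exists c d, c < d /\ forall t, c < t -> t < d -> E Y (t, y).
have main Y : dpred D (E Y) -> (exists V', [/\ open V', V' !=set0, V' `<=` V &
    forall y, V' y -> fib Y y]) ->
    exists W', [/\ open W', W' !=set0, W' `<=` W & W' `<=` Y].
  move=> dY [V' [oV' V'0 V'V fibV']].
  have [c [d [V2 [cd oV2 [y V2y] V2V' HE]]]] :=
    interval_fibers_of_decided IH dY oV' V'0 fibV'.
  exists [set w : 'rV[R]_(1 + n) |
    [/\ c < w ord0 (lshift n ord0), w ord0 (lshift n ord0) < d & V2 (rsubmx w)]].
  have rowE (w : 'rV[R]_(1 + n)) : w = row (w ord0 (lshift n ord0), rsubmx w).
    rewrite -[LHS]hsubmxK; congr row_mx.
    by apply/rowP => i; rewrite !mxE ord1.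
  split.
  - exact: box_open.
  - exists (row ((c + d) / 2, y)); rewrite /row /= row_mxKr row_mxEl mxE.
    by split=> //; lra.
  - move=> w [w1 w2 w3]; rewrite (rowE w).
    have [[/= ? ?] _] := HE _ _ w1 w2 w3.
    by apply: VW => //; apply/V'V/V2V'.
  - move=> w [w1 w2 w3]; rewrite (rowE w).
    by have [_ ] := HE _ _ w1 w2 w3.
have dfib : dpred D (fib X).
  rewrite /fib; definability.
  apply: (dpred_comp (f := fun z : 'rV[R]_n * R * R * R => (z.2, z.1.1.1))) dEX.
  by definability.
have [V' [oV' V'0 V'V [V'X|V'X]]] := IH _ dfib V oV V0.
- have [//||W' [? ? ? ?]] := main X; first by exists V'.
  by exists W'; split=> //; left.
(* Over [V'] no fibre of [X] contains an interval, so by tameness every fibre of the complement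
   contains one that starts at [a]. *)
- have [//||W' [? ? ? ?]] := main (~` X); last by exists W'; split=> //; right.
  exists V'; split=> // y V'y; have := V'X y V'y.
  have [|g|g nf] := @germ_decided R D (fun h => E X (a + h, y)).
  + by apply: (dpred_comp (f := fun h => (a + h, y))) dEX; definability.
  + move=> []; have [e [e0 He]] := g; exists a, (a + e); split; first lra.
    by move=> t t1 t2; have := He (t - a); rewrite subrKC; apply; lra.
  + have [e [e0 He]] := germ_and g (@germ_lt R (b - a) ltac:(lra)).
    exists a, (a + e); split; first lra.
    move=> t t1 t2; have [||] := He (t - a); [lra|lra|rewrite subrKC => nE tb].
    split=> /=; first by split; lra.
    by move=> Xr; apply: nE; split=> //=; split=> //; lra.
Qed.

Lemma interval_fibers n (E : R * 'rV[R]_n -> Prop) (V : set 'rV[R]_n) :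
  dpred D E -> open V -> V !=set0 ->
  (forall y, V y -> exists a b, a < b /\ forall t, a < t -> t < b -> E (t, y)) ->
  exists a b V', [/\ a < b, open V', V' !=set0, V' `<=` V &
    forall t y, a < t -> t < b -> V' y -> E (t, y)].
Proof.
by apply: interval_fibers_of_decided => X; exact: definable_locally_decided.
Qed.

(** If [f] were discontinuous throughout [W'], each point would lie in some [I q], the preimage of a
    rational interval, without being interior to it. By Baire a single [I q] minus its interior
    would contain a nonempty open set, which is absurd. [C] is continuity written coordinatewise, as
    a formula. *)
Lemma generic_continuous n (f : 'rV[R]_n -> R) :
  dfun D f -> generic setT [set z | {for z, continuous f}].
Proof.
move=> df W oW W0 _.
pose C (z : 'rV[R]_n) := forall e : R, 0 < e -> exists d : R, 0 < d /\
  forall z' : 'rV[R]_n, (forall i, `|z ord0 i - z' ord0 i| < d) -> `|f z - f z'| < e.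
have dC : definable D C.
  have dC : dpred D C.
    by rewrite /C; definability_with ltac:(apply: (dfun_comp df)).
  exact: dC.
have CP z : C z -> {for z, continuous f}.
  move=> Cz; apply/continuous_atP => e e0; have [d [d0 Hd]] := Cz e e0.
  by exists d => // z' zz'; apply/Hd/(ball_rV _ _ d0); rewrite -ball_normE.
have [W' [oW' W'0 W'W [W'C|W'C]]] := definable_locally_decided dC oW W0.
  by exists W'; split=> // z /W'C/CP.
pose I (q : rat * rat) := [set z | ratr q.1 < f z /\ f z < ratr q.2].
have dI q : definable D (I q).
  have dIq : dpred D (fun z : 'rV[R]_n => ratr q.1 < f z /\ f z < ratr q.2).
    by definability_with ltac:(apply: (dfun_comp df)).
  exact: dIq.
have [||q [W2 [oW2 [z W2z] W2W' W2B]]] :=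
    @baire_cover n _ (fun q => I q `\` interior (I q)) W' oW' W'0.
- move=> z /W'C nCz; apply: contrapT => noq; apply: nCz => e e0.
  have [q1 /andP[q1a q1b]] := @rat_in_itvoo R (f z - e) (f z) ltac:(lra).
  have [q2 /andP[q2a q2b]] := @rat_in_itvoo R (f z) (f z + e) ltac:(lra).
  rewrite !bnd_simp in q1a q1b q2a q2b.
  have : interior (I (q1, q2)) z.
    by apply: contrapT => nI; apply: noq; exists (q1, q2); split.
  move=> /nbhs_ballP[d /= d0 Hd]; exists d; split=> // z' /(ball_rV _ _ d0)/Hd [/=].
  by rewrite ltr_norml; lra.
- move=> q V oV V0; have [V' [oV' V'0 V'V [V'I|V'I]]] :=
    definable_locally_decided (dI q) oV V0.
    exists V'; split=> //; right => x V'x [_]; apply.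
    exact: filterS V'I (open_nbhs_nbhs (conj oV' V'x)).
  by exists V'; split=> //; right => x /V'I nI [].
have [_] := W2B z W2z; case.
by apply: filterS (open_nbhs_nbhs (conj oW2 W2z)) => x /W2B [].
Qed.

End Generic.

(** * Differentiability from partial derivatives *)

Section Norm.
Variable R : realType.

Lemma coord_le_norm m n (A : 'M[R]_(m, n)) i j : `|A i j| <= `|A|.
Proof.
rewrite [leRHS]/Num.norm /= mx_normrE.
by apply: (le_bigmax _ (fun ij => `|A ij.1 ij.2|) (i, j)).
Qed.

Lemma norm_le_coord m n (A : 'M[R]_(m, n)) e : 0 <= e ->
  (forall i j, `|A i j| <= e) -> `|A| <= e.
Proof.
move=> e0 Ae; rewrite [leLHS]/Num.norm /= mx_normrE.
by apply/bigmax_leP; split=> // ij _; apply: Ae.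
Qed.

Lemma norm_mulmx_le p q (v : 'rV[R]_p) (A : 'M[R]_(p, q)) :
  `|v *m A| <= (p%:R * `|A|) * `|v|.
Proof.
apply: norm_le_coord => [|i j]; first by rewrite !mulr_ge0.
rewrite mxE; apply: le_trans (ler_norm_sum _ _ _) _.
apply: (@le_trans _ _ (\sum_(k < p) `|A| * `|v|)).
  apply: ler_sum => k _; rewrite normrM mulrC.
  by apply: ler_pM => //; apply: coord_le_norm.
by rewrite sumr_const card_ord -[leLHS]mulr_natl mulrA.
Qed.

Lemma mulmxr_continuous p q (A : 'M[R]_(p, q)) :
  continuous (mulmxr A : 'rV[R]_p -> 'rV[R]_q).
Proof.
apply: bounded_linear_continuous.
exists (p%:R * `|A| * 1); split; first exact: num_real.
move=> M AM; near=> v; rewrite /= (le_trans (norm_mulmx_le v A)) // (le_trans _ (ltW AM)) //.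
apply: ler_wpM2l; first by rewrite mulr_ge0.
near: v; apply/nbhs_ballP; exists 1 => //= v.
by rewrite -ball_normE /= sub0r normrN => /ltW.
Unshelve. all: by end_near. Qed.

Definition has_differential (p q : nat) (g : 'rV[R]_p -> 'rV[R]_q)
    (A : 'M[R]_(p, q)) (z : 'rV[R]_p) : Prop :=
  forall e, 0 < e -> exists2 d, 0 < d & forall h, `|h| < d ->
    `|g (z + h) - g z - h *m A| <= e * `|h|.

Lemma has_differentialP p q (g : 'rV[R]_p -> 'rV[R]_q) A z :
  has_differential g A z -> differentiable g z /\ jacobian g z = A.
Proof.
move=> gA.
have H : g \o shift z = cst (g z) + mulmxr A +o_ 0 id.
  apply/eqaddoP => e e0; have [d d0 Hd] := gA e e0.
  apply/nbhs_ballP; exists d => //= h; rewrite -ball_normE /= sub0r normrN => /Hd.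
  by rewrite !fctE /= opprD addrA (addrC h).
have E := diff_unique (@mulmxr_continuous _ _ A) H.
split; first by apply/diff_locallyP; rewrite E; split=> //; apply: mulmxr_continuous.
apply/row_matrixP => i; rewrite !rowE mul_rV_lin1.
by rewrite E.
Qed.

End Norm.

Section Path.
Variable R : realType.

Lemma right_derivative_unique (f : R -> R) s L L' :
  right_derivative f s L -> right_derivative f s L' -> L = L'.
Proof.
move=> fL fL'; apply/eqP; rewrite -subr_eq0 -normr_eq0; apply/negPn/negP => LL'.
have e0 : 0 < `|L - L'| / 4 by rewrite divr_gt0 // lt_neqAle eq_sym LL' normr_ge0.
have [h h0 [h1 h2]] := germ_ex (germ_and (fL _ e0) (fL' _ e0)).
have : `|(L - L') * h| <= 2 * (`|L - L'| / 4 * h).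
  rewrite (_ : (L - L') * h = (f (s + h) - f s - h * L') - (f (s + h) - f s - h * L)).
    by apply: le_trans (ler_normB _ _) _; lra.
  by ring.
by rewrite normrM (gtr0_norm h0) mulrA ler_pM2r //; lra.
Qed.

(** The slack [e - |K - L|] absorbs the error of the right derivative, so the right slopes stay
    between [L - e] and [L + e]. Swapping the endpoints only changes a sign, hence right derivatives
    serve both orientations. *)
Lemma segment_estimate (f : R -> R) (a b L e : R) :
  (forall s, Num.min a b <= s <= Num.max a b -> {for s, continuous f} /\
    exists2 K, right_derivative f s K & `|K - L| < e) ->
  `|f b - f a - (b - a) * L| <= e * `|b - a|.
Proof.
wlog ab : a b / a <= b => [H|].
  have /orP[ab|ba] := le_total a b; first exact: H.
  move=> Hf; rewrite (_ : f b - f a - (b - a) * L = - (f a - f b - (a - b) * L)); last by ring.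
  rewrite normrN [`|b - a|]distrC.
  by apply: H => // s; rewrite minC maxC; apply: Hf.
rewrite min_l // max_r // => Hf.
have cf s : a <= s <= b -> {for s, continuous f} by move=> /Hf[].
have lo : f a + (L - e) * (b - a) <= f b.
  apply: right_slope_ge => // s /andP[sa sb].
  have [|_ [K fK KL]] := Hf s; first by rewrite sa ltW.
  have e0 : 0 < e - `|K - L| by rewrite subr_gt0.
  apply: germ_imp (fK _ e0) => h h0; rewrite ler_norml => /andP[H _].
  have : (L - e) * h <= (K - (e - `|K - L|)) * h.
    rewrite ler_pM2r //; have := ler_norm (L - K); rewrite distrC; lra.
  lra.
have up : f b <= f a + (L + e) * (b - a).
  apply: right_slope_le => // s /andP[sa sb].
  have [|_ [K fK KL]] := Hf s; first by rewrite sa ltW.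
  have e0 : 0 < e - `|K - L| by rewrite subr_gt0.
  apply: germ_imp (fK _ e0) => h h0; rewrite ler_norml => /andP[_ H].
  have : (K + (e - `|K - L|)) * h <= (L + e) * h.
    rewrite ler_pM2r //; have := ler_norm (K - L); lra.
  lra.
rewrite [`|b - a|]ger0_norm ?subr_ge0 // ler_norml; lra.
Qed.

(** One-sided, as germs are; where these slopes are continuous, [segment_estimate] turns them into
    two-sided derivatives. *)
Definition dir_derivative p (f : 'rV[R]_p -> R) (v z : 'rV[R]_p) (L : R) :=
  right_derivative (fun s => f (z + s *: v)) 0 L.

Lemma dir_derivative_shift p (f : 'rV[R]_p -> R) v z s L :
  dir_derivative f v (z + s *: v) L <-> right_derivative (fun s => f (z + s *: v)) s L.
Proof.
have E t : z + s *: v + t *: v = z + (s + t) *: v by rewrite scalerDl addrA.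
by split=> H e e0; apply: germ_imp (H e e0) => h h0; rewrite !E add0r addr0.
Qed.

Lemma line_continuous p (f : 'rV[R]_p -> R) (z v : 'rV[R]_p) s :
  {for z + s *: v, continuous f} -> {for s, continuous (fun s : R => f (z + s *: v))}.
Proof.
move=> cf; apply: (@continuous_comp _ _ _ (fun s : R => z + s *: v) f) => //.
by apply: cvgD; [exact: cvg_cst|apply: cvgZl; exact: cvg_id].
Qed.

(** The vertices of the coordinate path from 0 to [h], used again in [average_round]. *)
Definition truncate p (h : 'rV[R]_p) (k : nat) : 'rV[R]_p :=
  \row_i (if (i < k)%N then h ord0 i else 0).

Lemma truncate0 p (h : 'rV[R]_p) : truncate h 0 = 0.
Proof. by apply/rowP => i; rewrite !mxE. Qed.

Lemma truncate_full p (h : 'rV[R]_p) : truncate h p = h.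
Proof. by apply/rowP => i; rewrite !mxE ltn_ord. Qed.

Lemma truncateS p (h : 'rV[R]_p) (k : 'I_p) :
  truncate h k.+1 = truncate h k + h ord0 k *: delta_mx 0 k.
Proof.
apply/rowP => i; rewrite !mxE eqxx /= ltnS.
have [->|ik] := eqVneq i k; first by rewrite leqnn ltnn mulr1 add0r.
by rewrite mulr0 addr0 leq_eqVlt (inj_eq val_inj) (negbTE ik).
Qed.

(** One coordinate changes at a time. Every point of the path differs from [z] by coordinates
    between 0 and those of [h], so the path stays in the ball of radius [d] of the sup norm. *)
Lemma coordinate_path_estimate p (f : 'rV[R]_p -> R) (z h : 'rV[R]_p) (d e : R)
    (L : 'I_p -> R) : `|h| < d ->
  (forall y, `|y - z| < d -> {for y, continuous f} /\ forall i,
    exists2 K, dir_derivative f (delta_mx 0 i) y K & `|K - L i| < e) ->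
  `|f (z + h) - f z - \sum_i h ord0 i * L i| <= \sum_i e * `|h ord0 i|.
Proof.
move=> hd Hf.
pose y k := z + truncate h k.
have y0 : y 0%N = z by rewrite /y truncate0 addr0.
have yp : y p = z + h by rewrite /y truncate_full.
have step (k : 'I_p) : y k.+1 = y k + h ord0 k *: delta_mx 0 k.
  by rewrite /y truncateS addrA.
have -> : f (z + h) - f z = \sum_(k < p) (f (y k.+1) - f (y k)).
  by rewrite -(big_mkord xpredT (fun k => f (y k.+1) - f (y k))) telescope_sumr // yp y0.
rewrite -sumrB; apply: le_trans (ler_norm_sum _ _ _) _.
apply: ler_sum => k _; rewrite step.
have := @segment_estimate (fun s => f (y k + s *: delta_mx 0 k)) 0 (h ord0 k) (L k) e.
rewrite scale0r addr0 subr0; apply=> s sb.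
have /Hf[cy /(_ k) [K yK KL]] : `|(y k + s *: delta_mx 0 k) - z| < d.
  apply: le_lt_trans hd; apply: norm_le_coord => // i j.
  rewrite (ord1 i) /y addrAC [z + _]addrC addrK !mxE eqxx /=.
  have [->|jk] := eqVneq j k.
    rewrite ltnn add0r mulr1; apply: le_trans (coord_le_norm h ord0 k).
    move: sb; have /orP[h0|h0] := le_total 0 (h ord0 k).
      by rewrite min_l // max_r // (ger0_norm h0) ler_norml; lra.
    by rewrite min_r // max_l // (ler0_norm h0) ler_norml; lra.
  rewrite mulr0 addr0; case: ifP => _; first exact: coord_le_norm.
  by rewrite normr0.
split; first exact: line_continuous.
by exists K => //; apply/dir_derivative_shift.
Qed.

End Path.

(** * Generic smoothness of definable maps *)

Section GenericC1.
Variables (R : realType) (D : o_minimal_structure R).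

Lemma dpred_dir_derivative p (f : 'rV[R]_p -> R) v : dfun D f ->
  dpred D (fun z : 'rV[R]_p * R => dir_derivative f v z.1 z.2).
Proof.
move=> df; rewrite /dir_derivative /right_derivative.
apply: dpred_forall; apply: dpred_imp; first by definability.
apply: (dpred_germ (P := fun (z : 'rV[R]_p * R * R) h =>
  `|f (z.1.1 + (0 + h) *: v) - f (z.1.1 + 0 *: v) - h * z.1.2| <= z.2 * h)).
by definability_with ltac:(apply: (dfun_comp df)).
Qed.

(** The set is definable, so otherwise it would miss a nonempty open set; [right_derivative_exists]
    on a short segment of direction [v] forbids this. *)
Lemma generic_dir_derivative p (f : 'rV[R]_p -> R) v (O : set 'rV[R]_p) :
  dfun D f -> (forall z, O z -> {for z, continuous f}) ->
  generic O [set z | exists L, dir_derivative f v z L].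
Proof.
move=> df cf W oW W0 WO.
have dP : dpred D (fun z : 'rV[R]_p => exists L, dir_derivative f v z L).
  by apply: dpred_ex; apply: dpred_dir_derivative.
have [W' [oW' [z W'z] W'W [W'P|W'P]]] := definable_locally_decided dP oW W0.
  by exists W'; split=> //; exists z.
have cl s : {for s, continuous (fun s : R => z + s *: v)}.
  by apply: cvgD; [exact: cvg_cst|apply: cvgZl; exact: cvg_id].
have : \forall s \near (0 : R), W' (z + s *: v).
  apply: cl; apply: open_nbhs_nbhs; split=> //.
  by rewrite scale0r addr0.
move=> /nbhs_ballP[e /= e0 He].
have seg s : - e < s < e -> W' (z + s *: v).
  by move=> se; apply: He; rewrite -ball_normE /ball_ /= sub0r normrN ltr_norml.
have [||s /seg W's [L fL]] :=
    @right_derivative_exists _ D (fun s => f (z + s *: v)) (- e) e _ ltac:(lra).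
- by definability_with ltac:(apply: (dfun_comp df)).
- by move=> s /seg W's; apply: line_continuous; apply/cf/WO/W'W.
- by exfalso; apply: (W'P _ W's); exists L; apply/dir_derivative_shift.
Qed.

(** The default 0 makes this a total definable function, to which [generic_continuous] applies. *)
Definition slope p (f : 'rV[R]_p -> R) (v z : 'rV[R]_p) : R :=
  xget 0 [set L | dir_derivative f v z L].

Lemma slopeP p (f : 'rV[R]_p -> R) v z :
  (exists L, dir_derivative f v z L) -> dir_derivative f v z (slope f v z).
Proof. by move=> [L fL]; apply: (xgetPex 0 (ex_intro _ L fL)). Qed.

Lemma dfun_slope p (f : 'rV[R]_p -> R) v : dfun D f -> dfun D (slope f v).
Proof.
move=> df; have dd := dpred_dir_derivative v df.
have : dpred D (fun w : 'rV[R]_p * R => dir_derivative f v w.1 w.2 \/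
    ((~ exists L, dir_derivative f v w.1 L) /\ w.2 = 0)).
  definability.
  apply: (dpred_comp (f := fun z : 'rV[R]_p * R * R => (z.1.1, z.2))) dd.
  by definability.
apply: eq_dpred => -[z L] /=; split=> [[fL|[nL ->]]|<-].
- by apply: (right_derivative_unique _ fL); apply: slopeP; exists L.
- by rewrite /slope xgetPN // => L' fL'; apply: nL; exists L'.
- have [|nL] := pselect (exists L, dir_derivative f v z L).
    by move=> /slopeP; left.
  by right; rewrite /slope xgetPN // => L' fL'; apply: nL; exists L'.
Qed.

(** Where all right partial slopes exist and are continuous, the coordinate path shows that they
    form the differential. [g'] carries the definability, whereas the derivatives are those of [g],
    whose values outside [O] are arbitrary. *)
Lemma generic_C1 p (g g' : 'rV[R]_p -> 'rV[R]_p) (O : set 'rV[R]_p) :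
  dfun D g' -> open O -> (forall z, O z -> {for z, continuous g'}) ->
  (forall z, O z -> g z = g' z) ->
  generic O [set z | C1_at g z /\ has_differential g (jacobian g z) z].
Proof.
move=> dg oO cg gg'.
pose f (j : 'I_p) z := g' z ord0 j.
have df j : dfun D (f j) by rewrite /f; definability.
have cf j z : O z -> {for z, continuous (f j)}.
  move=> /cg cgz; apply: (@continuous_comp _ _ _ g' (fun v : 'rV[R]_p => v ord0 j)) => //.
  exact: coord_continuous.
pose e_ (i : 'I_p) : 'rV[R]_p := delta_mx 0 i.
have gP : generic O [set z | forall ij : 'I_p * 'I_p,
    ((exists L, dir_derivative (f ij.2) (e_ ij.1) z L) /\
     {for z, continuous (slope (f ij.2) (e_ ij.1))})].
  apply: generic_forall_fin => -[i j]; apply: generic_and.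
    by apply: generic_dir_derivative => //; apply: cf.
  by move=> W oW W0 _; apply: (generic_continuous (dfun_slope _ (df j))).
move=> W oW W0 WO; have [W' [oW' W'0 W'W W'P]] := gP W oW W0 WO.
exists W'; split=> //.
pose J z : 'M[R]_p := \matrix_(i, j) slope (f j) (e_ i) z.
have gJ z : W' z -> has_differential g (J z) z.
  move=> W'z e e0.
  (* The share of each of the [p] coordinates in the error; [p.+1] avoids a division by zero. *)
  have e'0 : 0 < e / p.+1%:R by rewrite divr_gt0.
  have : \forall y \near z, W' y /\ forall ij : 'I_p * 'I_p,
      `|slope (f ij.2) (e_ ij.1) z - slope (f ij.2) (e_ ij.1) y| < e / p.+1%:R.
    near=> y; split; first by near: y; apply: open_nbhs_nbhs.
    near: y; apply: filter_forall => -[i j].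
    have [_ /(@cvgrPdist_lt _ _ _ (nbhs z))] := W'P z W'z (i, j); exact.
  move=> /nbhs_ballP[d /= d0 Hd].
  exists d => // h hd.
  have near_z y : `|y - z| < d -> ball z d y.
    by rewrite -ball_normE /ball_ /= distrC.
  have zhd : `|z + h - z| < d by rewrite addrAC subrr add0r.
  have [W'zh _] := Hd _ (near_z _ zhd).
  apply: norm_le_coord => [|i j]; first by rewrite mulr_ge0 // ltW.
  rewrite (ord1 i) !gg' ?mxE; [|exact/WO/W'W..].
  have := @coordinate_path_estimate R p (f j) z h d (e / p.+1%:R)
    (fun i => slope (f j) (e_ i) z) hd.
  rewrite (eq_bigr (fun k => h ord0 k * J z k j)); last by move=> k _; rewrite mxE.
  move=> H; apply: le_trans (H _) _.
    move=> y /near_z/Hd [W'y /(_ (_, j)) yz]; split; first by apply/cf/WO/W'W.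
    move=> k; exists (slope (f j) (e_ k) y); last by rewrite distrC yz.
    by apply: slopeP; have [] := W'P y W'y (k, j).
  apply: (@le_trans _ _ (\sum_(k < p) e / p.+1%:R * `|h|)).
    by apply: ler_sum => k _; rewrite ler_pM2l // coord_le_norm.
  rewrite sumr_const card_ord -[leLHS]mulr_natl mulrA ler_wpM2r //.
  by rewrite mulrCA ger_pMr // ler_pdivrMr // mul1r ler_nat.
move=> z W'z; split; last by have [_ ->] := has_differentialP (gJ z W'z); apply: gJ.
have near_W y : W' y -> \forall w \near y, W' w by move=> W'y; apply: open_nbhs_nbhs.
rewrite /C1_at; apply: filterS (near_W z W'z) => y W'y.
have [dy Jy] := has_differentialP (gJ y W'y); split=> //.
apply/continuous_atP => e e0.
have near_slope : \forall w \near y, forall ij : 'I_p * 'I_p,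
    `|slope (f ij.2) (e_ ij.1) y - slope (f ij.2) (e_ ij.1) w| < e.
  apply: (@filter_forall _ ('I_p * 'I_p)%type _ (nbhs y) (nbhs_filter y)) => -[i j].
  have [_ /(@cvgrPdist_lt _ _ _ (nbhs y))] := W'P y W'y (i, j); exact.
have : nbhs y (W' `&` [set w | forall ij : 'I_p * 'I_p,
    `|slope (f ij.2) (e_ ij.1) y - slope (f ij.2) (e_ ij.1) w| < e]).
  by apply: filterI; [exact: near_W|exact: near_slope].
move=> /nbhs_ballP[d /= d0 Hd].
exists d => // w yw.
have [W'w {}Hd] := Hd w ltac:(by rewrite -ball_normE).
have [_ ->] := has_differentialP (gJ w W'w); rewrite Jy.
have : ball (J y) e (J w).
  split=> // i j; rewrite -ball_normE /= !mxE.
  exact: Hd (i, j).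
by rewrite -ball_normE.
Unshelve. all: by end_near. Qed.

End GenericC1.

(** * Euclidean geometry *)

Section Euclid.
Variable R : realType.

Definition dot p (u v : 'rV[R]_p) : R := (u *m v^T) ord0 ord0.

Section Dot.
Variable p : nat.
Implicit Types u v w x y : 'rV[R]_p.

Lemma dotE u v : dot u v = \sum_i u ord0 i * v ord0 i.
Proof. by rewrite /dot mxE; apply: eq_bigr => i _; rewrite mxE. Qed.

Lemma dotC u v : dot u v = dot v u.
Proof. by rewrite !dotE; apply: eq_bigr => i _; rewrite mulrC. Qed.

Lemma dotDl u v w : dot (u + v) w = dot u w + dot v w.
Proof. by rewrite /dot mulmxDl mxE. Qed.

Lemma dotNl u w : dot (- u) w = - dot u w.
Proof. by rewrite /dot mulNmx mxE. Qed.

Lemma dotZl a u w : dot (a *: u) w = a * dot u w.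
Proof. by rewrite /dot -scalemxAl mxE. Qed.

Lemma dotDr u v w : dot w (u + v) = dot w u + dot w v.
Proof. by rewrite dotC dotDl !(dotC w). Qed.

Lemma dotNr u w : dot w (- u) = - dot w u.
Proof. by rewrite dotC dotNl (dotC w). Qed.

Lemma dotZr a u w : dot w (a *: u) = a * dot w u.
Proof. by rewrite dotC dotZl (dotC w). Qed.

Lemma dot_ge0 u : 0 <= dot u u.
Proof. by rewrite dotE; apply: sumr_ge0 => i _; rewrite -expr2 sqr_ge0. Qed.

Lemma enormE u : enorm u = Num.sqrt (dot u u).
Proof. by rewrite /enorm dotE; under eq_bigr do rewrite expr2. Qed.

Lemma enorm_ge0 u : 0 <= enorm u.
Proof. exact: sqrtr_ge0. Qed.

Lemma sqr_enorm u : enorm u ^+ 2 = dot u u.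
Proof. by rewrite enormE sqr_sqrtr // dot_ge0. Qed.

Lemma coord_le_enorm u i : `|u ord0 i| <= enorm u.
Proof.
rewrite -(ler_pXn2r (ltn0Sn 1)) ?nnegrE ?enorm_ge0 // sqr_enorm dotE.
rewrite real_normK ?num_real // (bigD1 i) //= -expr2 lerDl.
by apply: sumr_ge0 => j _; rewrite -expr2 sqr_ge0.
Qed.

Lemma norm_le_enorm u : `|u| <= enorm u.
Proof.
apply: norm_le_coord => [|i j]; first exact: enorm_ge0.
by rewrite (ord1 i) coord_le_enorm.
Qed.

Lemma enorm_le_norm u : enorm u <= p%:R * `|u|.
Proof.
rewrite -(ler_pXn2r (ltn0Sn 1)) ?nnegrE ?enorm_ge0 ?mulr_ge0 // sqr_enorm dotE.
apply: (@le_trans _ _ (\sum_(i < p) `|u| ^+ 2)).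
  apply: ler_sum => i _; rewrite -expr2 -(real_normK (num_real (u ord0 i))).
  by rewrite ler_pXn2r ?nnegrE // coord_le_norm.
rewrite sumr_const card_ord -[leLHS]mulr_natl exprMn ler_wpM2r ?sqr_ge0 //.
by rewrite -natrX ler_nat; case: (p) => // k; rewrite -mulnn leq_pmulr.
Qed.

Lemma enorm_eq0 u : enorm u = 0 -> u = 0.
Proof.
move=> u0; apply/rowP => i; rewrite mxE; apply/eqP.
by rewrite -normr_le0 -u0 coord_le_enorm.
Qed.

Lemma cauchy_schwarz u v : dot u v <= enorm u * enorm v.
Proof.
have [->|v0] := eqVneq v 0.
  rewrite (_ : dot u 0 = 0) ?mulr_ge0 ?enorm_ge0 //.
  by rewrite dotE big1 // => i _; rewrite mxE mulr0.
have ev : 0 < enorm v.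
  by rewrite lt_neqAle enorm_ge0 andbT eq_sym; apply: contra_neq v0 => /enorm_eq0.
apply: le_trans (ler_norm _) _.
rewrite -(ler_pXn2r (ltn0Sn 1)) ?nnegrE ?mulr_ge0 ?enorm_ge0 //.
rewrite real_normK ?num_real // exprMn !sqr_enorm.
have vv : 0 < dot v v by rewrite -sqr_enorm exprn_gt0.
have := dot_ge0 (dot v v *: u - dot u v *: v).
rewrite !(dotDl, dotDr, dotNl, dotNr, dotZl, dotZr) (dotC v u).
rewrite (_ : _ + _ = dot v v * (dot u u * dot v v - dot u v ^+ 2)); last by ring.
by rewrite pmulr_rge0 // subr_ge0.
Qed.

Lemma sqr_enormD u v :
  enorm (u + v) ^+ 2 = enorm u ^+ 2 + 2 * dot u v + enorm v ^+ 2.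
Proof. by rewrite !sqr_enorm dotDl !dotDr (dotC v u); ring. Qed.

Lemma enormD u v : enorm (u + v) <= enorm u + enorm v.
Proof.
rewrite -(ler_pXn2r (ltn0Sn 1)) ?nnegrE ?addr_ge0 ?enorm_ge0 //.
rewrite sqr_enormD sqrrD.
have := cauchy_schwarz u v; lra.
Qed.

Lemma enormZ a u : enorm (a *: u) = `|a| * enorm u.
Proof. by rewrite !enormE dotZl dotZr mulrA -expr2 sqrtrM ?sqr_ge0 // sqrtr_sqr. Qed.

Lemma enormN u : enorm (- u) = enorm u.
Proof. by rewrite -scaleN1r enormZ normrN1 mul1r. Qed.

Lemma enorm0 : enorm (0 : 'rV[R]_p) = 0.
Proof. by rewrite -(scale0r 0) enormZ normr0 mul0r. Qed.

Lemma enorm_gt0 u : u != 0 -> 0 < enorm u.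
Proof.
move=> u0; rewrite lt_neqAle enorm_ge0 andbT eq_sym.
by apply: contra_neq u0 => /enorm_eq0.
Qed.

Lemma enorm_distC u v : enorm (u - v) = enorm (v - u).
Proof. by rewrite -enormN opprB. Qed.

Lemma enorm_continuous : continuous (@enorm R p).
Proof.
move=> u; apply/continuous_atP => e e0.
exists (e / p.+1%:R) => [|v uv]; first by rewrite divr_gt0.
have : enorm (u - v) < e.
  apply: le_lt_trans (enorm_le_norm _) _.
  apply: (@le_lt_trans _ _ (p%:R * (e / p.+1%:R))); first by rewrite ler_wpM2l // ltW.
  by rewrite mulrCA gtr_pMr // ltr_pdivrMr // mul1r ltr_nat.
have h1 := enormD (u - v) v; have h2 := enormD (v - u) u.
rewrite !subrK (enorm_distC v u) in h1 h2.
rewrite ltr_norml; lra.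
Qed.

Lemma enorm_dist_continuous a : continuous (fun x : 'rV[R]_p => enorm (x - a)).
Proof.
move=> x; apply: (@continuous_comp _ _ _ (fun x : 'rV[R]_p => x - a) (@enorm R p)).
  by apply/continuous_atP => e e0; exists e => // y xy; rewrite opprB addrA subrK.
exact: enorm_continuous.
Qed.

Lemma eball_open (a : 'rV[R]_p) r : open (eball a r).
Proof.
apply: (@open_comp _ _ (fun x : 'rV[R]_p => enorm (x - a)) [set s : R | s < r]).
  by move=> x _; apply: enorm_dist_continuous.
exact: open_lt.
Qed.

Lemma eball_convex (a : 'rV[R]_p) r x y (t : R) : 0 <= t <= 1 ->
  eball a r x -> eball a r y -> eball a r (x + t *: (y - x)).
Proof.
move=> /andP[t0 t1]; rewrite /eball /= => xr yr.
have -> : x + t *: (y - x) - a = (1 - t) *: (x - a) + t *: (y - a).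
  by apply/rowP => i; rewrite !mxE; ring.
apply: le_lt_trans (enormD _ _) _.
rewrite !enormZ !ger0_norm ?subr_ge0 //.
have [m [ma mb mr]] : exists m, [/\ enorm (x - a) <= m, enorm (y - a) <= m & m < r].
  exists (Num.max (enorm (x - a)) (enorm (y - a))); split.
  - by rewrite le_max lexx.
  - by rewrite le_max lexx orbT.
  - by rewrite gt_max xr.
apply: le_lt_trans mr.
have -> : m = (1 - t) * m + t * m by ring.
by apply: lerD; apply: ler_wpM2l => //; rewrite subr_ge0.
Qed.

Lemma closed_eball_compact (a : 'rV[R]_p) r :
  compact [set x : 'rV[R]_p | enorm (x - a) <= r].
Proof.
apply: bounded_closed_compact.
  exists (`|a| + r); split; first exact: num_real.
  move=> M rM x /= xr; apply: (le_trans _ (ltW rM)).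
  rewrite -[x](subrK a) addrC; apply: le_trans (ler_normD _ _) _.
  by rewrite lerD2l (le_trans (norm_le_enorm _)).
apply: (@preimage_closed _ _ (fun x : 'rV[R]_p => enorm (x - a)) [set s : R | s <= r]).
  by move=> x _; apply: enorm_dist_continuous.
exact: closed_le.
Qed.

(* [u] is the direction of the point [w] of least norm in the closure of [C]. *)
Lemma convex_separation (C : set 'rV[R]_p) (c : R) (u0 : 'rV[R]_p) :
  enorm u0 = 1 -> 0 < c ->
  (forall x y (t : R), 0 <= t <= 1 -> C x -> C y -> C (x + t *: (y - x))) ->
  (forall x, C x -> c <= enorm x) ->
  exists2 u, enorm u = 1 & forall x, C x -> c <= dot u x.
Proof.
move=> u01 c0 convC Cc.
(* For empty [C] any unit vector will do, and [u0] supplies one. *)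
have [[x0 Cx0]|C0] := pselect (C !=set0); last first.
  by exists u0 => // x Cx; exfalso; apply: C0; exists x.
pose A := closure C `&` [set x : 'rV[R]_p | enorm (x - 0) <= enorm x0].
have cA : compact A.
  rewrite /A setIC; apply: compact_closedI; last exact: closed_closure.
  exact: closed_eball_compact.
have A0 : A x0 by split; [exact: subset_closure|rewrite /= subr0].
have [w /set_mem [Cw _] wA] : exists2 w, w \in A & forall x, x \in A -> enorm w <= enorm x.
  apply: EVT_min_rV => //; first by exists x0.
  by apply: continuous_subspaceT => x; exact: enorm_continuous.
have wC x : closure C x -> enorm w <= enorm x.
  move=> Cx; have [xx0|/ltW x0x] := lerP (enorm x) (enorm x0).
    by apply/wA/mem_set; split=> //=; rewrite subr0.
  by apply: le_trans x0x; apply/wA/mem_set.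
have wc : c <= enorm w.
  have cl : closed ((@enorm R p) @^-1` [set s | c <= s]).
    by apply: preimage_closed => [x _|]; [exact: enorm_continuous|exact: closed_ge].
  by apply: cl; apply: (closure_subset _ Cw) => x /Cc.
have w0 : 0 < enorm w by apply: lt_le_trans wc.
have wx x : C x -> enorm w ^+ 2 <= dot w x.
  move=> Cx.
  have clC t : 0 <= t <= 1 -> closure C (w + t *: (x - w)).
    move=> t01.
    have : closed ((fun y => y + t *: (x - y)) @^-1` closure C).
      apply: preimage_closed => [y _|]; last exact: closed_closure.
      apply: (@cvgD _ _ _ (nbhs y) _ id (fun y => t *: (x - y))); first exact: cvg_id.
      apply: cvgZr; apply: (@cvgB _ _ _ (nbhs y) _ (cst x) id); [exact: cvg_cst|exact: cvg_id].
    move=> cl; apply: cl; apply: (closure_subset _ Cw) => y Cy.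
    by apply: subset_closure; apply: convC.
  rewrite leNgt; apply/negP => wxlt.
  pose q := dot (x - w) (x - w).
  have q0 : 0 <= q by apply: dot_ge0.
  pose d := enorm w ^+ 2 - dot w x.
  have d0 : 0 < d by rewrite subr_gt0.
  (* The squared norm of [w + t *: (x - w)] is [|w|^2 - 2 t d + t^2 q]; as [t q <= d], it is at most
     [|w|^2 - t d], against the minimality of [w]. *)
  pose t := Num.min 1 (d / (q + 1)).
  have t0 : 0 < t by rewrite lt_min ltr01 divr_gt0 //; lra.
  have tq : t * q <= d.
    apply: (@le_trans _ _ (d / (q + 1) * q)).
      by rewrite ler_wpM2r // ge_min lexx orbT.
    by rewrite mulrAC ler_pdivrMr; nra.
  have /wC : closure C (w + t *: (x - w)).
    by apply: clC; rewrite (ltW t0) ge_min lexx.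
  rewrite -(ler_pXn2r (ltn0Sn 1)) ?nnegrE ?enorm_ge0 // !sqr_enorm.
  rewrite dotDl !dotDr !dotZl !dotZr -/q (dotC (x - w) w) dotDr dotNr -sqr_enorm.
  rewrite -/d in tq *; have -> : dot w x = enorm w ^+ 2 - d by rewrite /d; ring.
  nra.
exists ((enorm w)^-1 *: w) => [|x Cx].
  by rewrite enormZ ger0_norm ?invr_ge0 ?enorm_ge0 // mulVf // gt_eqF.
apply: le_trans wc _; rewrite dotZl -ler_pdivrMl ?invr_gt0 // invrK -expr2.
exact: wx.
Qed.

End Dot.

Lemma dot_mulmx p (A : 'M[R]_p) (u v : 'rV[R]_p) :
  dot u (v *m A^T) = dot (u *m A) v.
Proof. by rewrite /dot trmx_mul trmxK mulmxA. Qed.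

Lemma dot_le_norm p (u v : 'rV[R]_p) : `|dot u v| <= p%:R * `|u| * `|v|.
Proof.
rewrite dotC; apply: le_trans (coord_le_norm _ _ _) _.
apply: le_trans (norm_mulmx_le _ _) _.
rewrite ler_wpM2r // ler_wpM2l //.
by apply: norm_le_coord => // i j; rewrite mxE coord_le_norm.
Qed.

End Euclid.

(** * Mean value inequality *)

Section MeanValue.
Variables (R : realType) (D : o_minimal_structure R).

Lemma dfun_dot T (cT : chart R T) p (u : 'rV[R]_p) (g : T -> 'rV[R]_p) :
  dfun D g -> dfun D (fun x => dot u (g x)).
Proof.
move=> dg; have : dfun D (fun x => \sum_i u ord0 i * g x ord0 i).
  by apply: dfun_sum => i; definability.
by congr dfun; apply/funext => x; rewrite dotE.
Qed.

Lemma dot_continuous p (u : 'rV[R]_p) : continuous (dot u).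
Proof.
move=> v; apply/continuous_atP => e e0.
have k0 : 0 < p%:R * `|u| + 1 by rewrite ltr_wpDl // mulr_ge0.
exists (e / (p%:R * `|u| + 1)) => [|w vw]; first by rewrite divr_gt0.
rewrite -dotNr -dotDr; apply: le_lt_trans (dot_le_norm _ _) _.
apply: (@le_lt_trans _ _ (p%:R * `|u| * (e / (p%:R * `|u| + 1)))).
  by rewrite ler_wpM2l ?mulr_ge0 // ltW.
by rewrite mulrCA gtr_pMr // ltr_pdivrMr // mul1r ltrDl.
Qed.

(* Otherwise [dot u g - k' s] decreases along the segments of direction [v]
   starting near [y], for some [k' < k]; each of them contains an interval of
   points of decrease, hence these points contain an open set, on which [g] is
   [C1] somewhere. *)
Lemma mean_value_inequality p (g g' : 'rV[R]_p -> 'rV[R]_p) (O : set 'rV[R]_p)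
    (u v : 'rV[R]_p) (k : R) :
  dfun D g' -> open O ->
  (forall x y (s : R), 0 <= s <= 1 -> O x -> O y -> O (x + s *: (y - x))) ->
  (forall z, O z -> {for z, continuous g'}) -> (forall z, O z -> g z = g' z) ->
  (forall z, O z -> C1_at g z -> k <= dot u (v *m jacobian g z)) ->
  forall y (t : R), 0 <= t -> O y -> O (y + t *: v) ->
    k * t <= dot u (g (y + t *: v) - g y).
Proof.
move=> dg oO convO cg gg' gk y0 t t0 Oy0 Oy0t.
rewrite !gg' // leNgt; apply/negP => lt_k.
have {}t0 : 0 < t.
  rewrite lt_neqAle t0 andbT; apply/eqP => E; move: lt_k.
  by rewrite -E scale0r addr0 subrr mulr0 -(scale0r 0) dotZr mul0r ltxx.
pose f z := dot u (g' z).
have df : dfun D f by apply: dfun_dot; definability.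
have cf z : O z -> {for z, continuous f}.
  by move=> /cg cgz; apply: (@continuous_comp _ _ _ g' (dot u)) => //; apply: dot_continuous.
rewrite dotDr dotNr -!/(f _) in lt_k.
(* Midway between the mean slope on the violating segment and [k]: the first gap lets the violation
   survive a perturbation of [y0], the second absorbs the error of linearisation. *)
pose k' := ((f (y0 + t *: v) - f y0) / t + k) / 2.
have k'k : k' < k.
  have : (f (y0 + t *: v) - f y0) / t < k by rewrite ltr_pdivrMr.
  rewrite /k'; lra.
have k'f : f (y0 + t *: v) - f y0 < k' * t.
  have : (f (y0 + t *: v) - f y0) / t < k' by rewrite /k'; have := lt_k; rewrite -ltr_pdivrMr //; lra.
  by rewrite ltr_pdivrMr.
have seg y s : O y -> O (y + t *: v) -> 0 <= s <= t -> O (y + s *: v).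
  move=> Oy Oyt /andP[s0 st]; have := convO y (y + t *: v) (s / t) _ Oy Oyt.
  rewrite addrAC subrr add0r scalerA divfK ?gt_eqF //; apply.
  by rewrite divr_ge0 ?(ltW t0) // ler_pdivrMr // mul1r.
have shiftc (w : 'rV[R]_p) : continuous (fun y => y + w).
  move=> y; apply/continuous_atP => e e0; exists e => // z.
  by rewrite opprD addrACA subrr addr0.
have : \forall y \near y0, [/\ O y, O (y + t *: v) & f (y + t *: v) - f y < k' * t].
  have cft : {for y0, continuous (fun y => f (y + t *: v) - f y)}.
    apply: (@cvgB _ _ _ (nbhs y0) _ (fun y => f (y + t *: v)) f); last exact: cf.
    by apply: (@continuous_comp _ _ _ (fun y => y + t *: v) f);
      [exact: shiftc|exact: cf].
  have near_lt : nbhs y0 ((fun y => f (y + t *: v) - f y) @^-1` [set s | s < k' * t]).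
    by apply: cft; apply: open_nbhs_nbhs; split; [exact: open_lt|exact: k'f].
  near=> y; split.
  - by near: y; apply: open_nbhs_nbhs.
  - near: y; apply: (shiftc (t *: v) y0); apply: open_nbhs_nbhs; split=> //.
  - by near: y; exact: near_lt.
move=> /nbhs_ballP[d /= d0 Hd].
pose F (y : 'rV[R]_p) (s : R) := f (y + s *: v) - k' * s.
pose E (z : R * 'rV[R]_p) :=
  (0 < z.1 /\ z.1 < t) /\ germ (fun h => F z.2 (z.1 + h) < F z.2 z.1).
have dE : dpred D E.
  apply: dpred_and; first by definability.
  apply: dpred_germ; rewrite /F.
  by definability_with ltac:(apply: (dfun_comp df)).
have [|y By|a [b [V' [ab oV' [y1 V'y1] V'V V'E]]]] :=
    @interval_fibers R D p E (ball y0 d) dE (@ball_open _ _ y0 d).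
- by exists y0; apply: ballxx.
- have [Oy Oyt fy] := Hd y By.
  have [|//|s st||a [b [a0 ab bt Hab]]] :=
    @decreasing_germs_on_interval R D (F y) 0 t.
  + by rewrite /F; definability_with ltac:(apply: (dfun_comp df)).
  + apply: cvgB; first exact/line_continuous/cf/seg.
    by apply: cvgMr; exact: cvg_id.
  + by rewrite /F scale0r addr0 mulr0 subr0; lra.
  + exists a, b; split=> // s sa sb; split=> /=; last exact: Hab.
    by split; lra.
pose s0 := (a + b) / 2.
have s0ab : a < s0 /\ s0 < b by rewrite /s0; split; lra.
(* With the parameter frozen at [s0], translating [V'] along [v] gives an open set of points after
   which [f] grows more slowly than [k'] in the direction [v]. *)
pose Z := [set z : 'rV[R]_p | V' (z + (- s0) *: v)].
have oZ : open Z.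
  apply: (@open_comp _ _ (fun z : 'rV[R]_p => z + (- s0) *: v) V'); last exact: oV'.
  by move=> z _; apply: shiftc.
have ZO z : Z z -> O z /\ germ (fun h => f (z + h *: v) - f z < k' * h).
  move=> Zz; have [[/= s1 s2] gz] := V'E _ _ s0ab.1 s0ab.2 Zz.
  have Ez : z = z + (- s0) *: v + s0 *: v by rewrite scaleNr subrK.
  split.
    have [Oy Oyt _] := Hd _ (V'V _ Zz).
    by rewrite Ez; apply: seg; rewrite ?(ltW s1) ?(ltW s2).
  apply: germ_imp gz => h h0; rewrite /F /= scalerDl addrA -Ez; lra.
have Z0 : Z !=set0.
  by exists (y1 + s0 *: v); rewrite /Z /= scaleNr addrK.
have [W [oW [z Wz] WZ WC]] := generic_C1 dg oO cg gg' oZ Z0 (fun z Zz => (ZO z Zz).1).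
have [C1z gz] := WC z Wz; have [Oz fz] := ZO z (WZ z Wz).
have kz := gk z Oz C1z.
(* The linear approximation of [g] costs at most [p |u| e |v| h], which must stay below
   [(k - k') h]; the 1 covers [u = 0] and [v = 0]. *)
pose e := (k - k') / (2 * (p%:R * `|u| * `|v| + 1)).
have M0 : 0 <= p%:R * `|u| * `|v| by rewrite !mulr_ge0.
have e0 : 0 < e by rewrite divr_gt0 ?subr_gt0 // mulr_gt0 // ltr_wpDl.
have eM : e * (p%:R * `|u| * `|v|) < k - k'.
  rewrite /e mulrAC ltr_pdivrMr; last by rewrite mulr_gt0 // ltr_wpDl.
  by rewrite ltr_pM2l ?subr_gt0 //; lra.
have [d1 d10 Hd1] := gz e e0.
have : \forall h \near (0 : R), O (z + h *: v).
  have cl : {for (0 : R), continuous (fun s : R => z + s *: v)}.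
    by apply: cvgD; [exact: cvg_cst|apply: cvgZl; exact: cvg_id].
  by apply: cl; apply: open_nbhs_nbhs; split=> //; rewrite scale0r addr0.
move=> /nbhs_ballP[d2 /= d20 Hd2].
have gd1 : germ (fun h => h * `|v| < d1).
  exists (d1 / (`|v| + 1)); split; first by rewrite divr_gt0 // ltr_wpDl.
  move=> h h0; rewrite ltr_pdivlMr ?ltr_wpDl //; apply: le_lt_trans.
  by rewrite ler_pM2l // lerDl.
have [h h0 [[f1 h1] h2]] := germ_ex (germ_and (germ_and fz gd1) (@germ_lt R d2 d20)).
have /Hd1 : `|h *: v| < d1 by rewrite normrZ gtr0_norm.
have Ozh : O (z + h *: v).
  by apply: Hd2; rewrite -ball_normE /ball_ /= sub0r normrN gtr0_norm.
rewrite normrZ (gtr0_norm h0) -scalemxAl => err.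
have := dot_le_norm u (g (z + h *: v) - g z - h *: (v *m jacobian g z)).
rewrite !dotDr !dotNr dotZr !gg' // -/(f _) -/(f _) ler_norml => /andP[lo _].
have e1 : p%:R * `|u| * `|g (z + h *: v) - g z - h *: (v *m jacobian g z)|
    <= e * (p%:R * `|u| * `|v|) * h.
  rewrite [leRHS](_ : _ = p%:R * `|u| * (e * (h * `|v|))); last by ring.
  by rewrite ler_wpM2l // mulr_ge0.
have e2 : e * (p%:R * `|u| * `|v|) * h < (k - k') * h by rewrite ltr_pM2r.
have e3 : k * h <= h * dot u (v *m jacobian g z) by rewrite mulrC ler_pM2l.
rewrite !gg' // in e1; lra.
Unshelve. all: by end_near. Qed.

End MeanValue.

(** * Averages over small cubes *)

Section Averaging.
Variables (R : realType) (p : nat).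
Implicit Types (g h : 'rV[R]_p -> 'rV[R]_p) (s : seq 'I_p) (x y z w : 'rV[R]_p).

Lemma enorm_delta (i : 'I_p) : enorm (delta_mx 0 i : 'rV[R]_p) = 1.
Proof.
rewrite enormE dotE (bigD1 i) //= mxE !eqxx mulr1 big1 ?addr0 ?sqrtr1 // => j ji.
by rewrite mxE (negbTE ji) andbF mulr0.
Qed.

Lemma ler_enorm x y : (forall i, `|x ord0 i| <= `|y ord0 i|) -> enorm x <= enorm y.
Proof.
move=> xy; rewrite -(ler_pXn2r (ltn0Sn 1)) ?nnegrE ?enorm_ge0 // !sqr_enorm !dotE.
apply: ler_sum => i _; rewrite -!expr2.
by rewrite -(real_normK (num_real (x ord0 i))) -(real_normK (num_real (y ord0 i)))
  ler_pXn2r ?nnegrE.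
Qed.

Lemma enorm_sum (I : Type) (r : seq I) (f : I -> 'rV[R]_p) :
  enorm (\sum_(i <- r) f i) <= \sum_(i <- r) enorm (f i).
Proof.
elim: r => [|i r IH]; first by rewrite !big_nil enorm0.
by rewrite !big_cons; apply: le_trans (enormD _ _) _; rewrite lerD2l.
Qed.

Section Grid.
Variables (N : nat) (a : R).
Hypothesis a0 : 0 <= a.

Let e : R := N.+1%:R * a.

(** The mean of [g] over the grid points [y + sum_i k_i a e_i] with [0 <= k_i <= N] and [i] in [s]:
    a discrete convolution with a cube of side [e]. *)
Fixpoint average g s y : 'rV[R]_p :=
  if s is i :: s' then
    N.+1%:R^-1 *: \sum_(k < N.+1) average g s' (y + (k%:R * a) *: delta_mx 0 i)
  else g y.

Let shift_le (i : 'I_p) (k : nat) : (k <= N.+1)%N ->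
  enorm ((k%:R * a) *: delta_mx 0 i : 'rV[R]_p) <= e.
Proof.
by move=> kN; rewrite enormZ enorm_delta mulr1 ger0_norm ?mulr_ge0 // ler_wpM2r // ler_nat.
Qed.

(** Iterated means preserve any property closed under means with equal weights, such as membership
    in a half-space or a ball. Each direction moves the base point by at most [e], whence the
    radius. *)
Lemma average_ind (K : 'rV[R]_p -> Prop) :
  (forall x : 'I_N.+1 -> 'rV[R]_p, (forall k, K (x k)) ->
    K (N.+1%:R^-1 *: \sum_k x k)) ->
  forall g s y, (forall z, enorm (z - y) <= (size s)%:R * e -> K (g z)) ->
  K (average g s y).
Proof.
move=> KN g s; elim: s => [|i s IH] y Kg /=; first by apply: Kg; rewrite subrr enorm0 mul0r.
apply: KN => k; apply: IH => z zy; apply: Kg.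
pose q : 'rV[R]_p := ((k : nat)%:R * a) *: delta_mx 0 i; rewrite -/q in zy.
have -> : z - y = z - (y + q) + q by rewrite opprD addrA subrK.
apply: le_trans (enormD _ _) _; rewrite -natr1 mulrDl mul1r.
by apply: lerD => //; apply: shift_le; apply: ltnW.
Qed.

Lemma average_dot_ge g s y u (k : R) :
  (forall z, enorm (z - y) <= (size s)%:R * e -> k <= dot u (g z)) ->
  k <= dot u (average g s y).
Proof.
apply: (@average_ind (fun x => k <= dot u x)) => x kx.
rewrite dotZr -ler_pdivrMl ?invr_gt0 // invrK.
have -> : dot u (\sum_i x i) = \sum_i dot u (x i).
  by apply: (big_morph (dot u)) => [v w|]; rewrite ?dotDr // -(scale0r 0) dotZr mul0r.
rewrite -[X in X * _]/(N.+1%:R) mulr_natl -[X in _ *+ X]card_ord -sumr_const.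
exact: ler_sum.
Qed.

Lemma average_enorm_le g s y w (d : R) :
  (forall z, enorm (z - y) <= (size s)%:R * e -> enorm (g z - w) <= d) ->
  enorm (average g s y - w) <= d.
Proof.
apply: (@average_ind (fun x => enorm (x - w) <= d)) => x dx.
have -> : w = N.+1%:R^-1 *: \sum_(k < N.+1) w.
  by rewrite sumr_const card_ord -[w *+ _]scaler_nat scalerA mulVf ?scale1r // pnatr_eq0.
rewrite -scalerBr -sumrB enormZ ger0_norm ?invr_ge0 // ler_pdivrMl //.
apply: le_trans (enorm_sum _ _) _.
by rewrite mulr_natl -[X in _ *+ X]card_ord -sumr_const; apply: ler_sum.
Qed.

(** Lets bounds on the increments of [g] pass to the increments of its average. *)
Lemma average_translateB g s y w :
  average (fun z => g (z + w) - g z) s y = average g s (y + w) - average g s y.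
Proof.
elim: s y => [|i s IH] y //=; rewrite -scalerBr -sumrB; congr (_ *: _).
by apply: eq_bigr => k _; rewrite IH addrAC.
Qed.

Section Bounded.
Variables (g : 'rV[R]_p -> 'rV[R]_p) (b : 'rV[R]_p) (M rho : R).
Hypothesis gM : forall z, enorm (z - b) <= rho -> enorm (g z) <= M.

Lemma average_bounded s y :
  enorm (y - b) + (size s)%:R * e <= rho -> enorm (average g s y) <= M.
Proof.
move=> yrho; rewrite -[average g s y]subr0; apply: average_enorm_le => z zy.
rewrite subr0; apply: gM; have -> : z - b = (z - y) + (y - b) by rewrite addrA subrK.
by apply: le_trans (enormD _ _) _; lra.
Qed.

Let bound_shift (i : 'I_p) y (k : nat) (x : R) : (k <= N.+1)%N ->
  enorm (y - b) + (x + 1) * e <= rho ->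
  enorm (y + (k%:R * a) *: delta_mx 0 i - b) + x * e <= rho.
Proof.
move=> kN; rewrite mulrDl mul1r; apply: le_trans.
rewrite addrAC; have := enormD (y - b) ((k%:R * a) *: delta_mx 0 i).
have := shift_le i kN; lra.
Qed.

(* The sum over [k] telescopes in the direction [i]. *)
Lemma average_grid_step s i y : i \in s ->
  enorm (y - b) + ((size s)%:R + 1) * e <= rho ->
  enorm (average g s (y + a *: delta_mx 0 i) - average g s y) <= 2 * M / N.+1%:R.
Proof.
have e0 : 0 <= e by rewrite mulr_ge0.
elim: s y => [//|j s IH] y /=; rewrite inE -natr1 => ijs yrho.
rewrite -scalerBr -sumrB enormZ ger0_norm ?invr_ge0 // mulrC ler_wpM2r ?invr_ge0 //.
have [ij|ij] := eqVneq i j.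
  pose G k := average g s (y + (k%:R * a) *: delta_mx 0 j).
  rewrite (eq_bigr (fun k : 'I_N.+1 => G k.+1 - G k)); last first.
    move=> k _; congr (_ - _); rewrite /G ij -addrA -scalerDl; congr (average _ _ (_ + _ *: _)).
    by rewrite -natr1 mulrDl mul1r addrC.
  rewrite -(big_mkord xpredT (fun k => G k.+1 - G k)) telescope_sumr //.
  apply: le_trans (enormD _ _) _; rewrite enormN.
  have GM k : (k <= N.+1)%N -> enorm (G k) <= M.
    move=> kN; apply: average_bounded; apply: bound_shift => //.
    by apply: le_trans yrho; rewrite lerD2l ler_wpM2r // -addrA lerD2l; lra.
  have := GM N.+1 (leqnn _); have := GM 0%N isT; lra.
have is' : i \in s by move: ijs; rewrite (negbTE ij).
apply: le_trans (enorm_sum _ _) _.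
apply: (@le_trans _ _ (\sum_(k < N.+1) 2 * M / N.+1%:R)).
  apply: ler_sum => k _; rewrite addrAC; apply: IH => //.
  by apply: bound_shift => //; apply: ltnW.
by rewrite sumr_const card_ord -[leLHS]mulr_natl mulrC divfK // pnatr_eq0.
Qed.

(** For [a > 0] the bound is [(m a) (2 M / e)]: a rate fixed by the side of the cube, whatever the
    mesh. *)
Lemma average_grid_steps s i y (m : nat) rho' : i \in s ->
  rho' + ((size s)%:R + 1) * e <= rho -> enorm (y - b) + m%:R * a <= rho' ->
  enorm (average g s (y + (m%:R * a) *: delta_mx 0 i) - average g s y)
    <= m%:R * (2 * M / N.+1%:R).
Proof.
move=> is' rr; elim: m => [|m IH] ym.
  by rewrite mul0r scale0r addr0 subrr enorm0 mul0r.
rewrite -natr1 ![(m%:R + 1) * _]mulrDl !mul1r in ym *.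
set z := y + (m%:R * a) *: delta_mx 0 i.
have -> : y + (m%:R * a + a) *: delta_mx 0 i = z + a *: delta_mx 0 i.
  by rewrite scalerDl addrA.
have -> : average g s (z + a *: delta_mx 0 i) - average g s y =
    (average g s z - average g s y) + (average g s (z + a *: delta_mx 0 i) - average g s z).
  by rewrite [RHS]addrC addrA subrK.
apply: le_trans (enormD _ _) _; apply: lerD; first by apply: IH; apply: le_trans ym; rewrite addrA lerDl.
apply: average_grid_step => //; apply: le_trans rr; rewrite lerD2r.
rewrite /z addrAC; apply: le_trans (enormD _ _) _.
by rewrite enormZ enorm_delta mulr1 ger0_norm ?mulr_ge0 //; apply: le_trans ym; rewrite addrA lerDl.
Qed.

(** A backward move is a forward move from its endpoint, which may be farther from [b] by [m a];
    hence the factor 2 in the hypothesis. *)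
Lemma average_signed_steps s i y (m : nat) (sg : bool) rho' : i \in s ->
  rho' + ((size s)%:R + 1) * e <= rho -> enorm (y - b) + 2 * (m%:R * a) <= rho' ->
  enorm (average g s (y + ((-1) ^+ sg * (m%:R * a)) *: delta_mx 0 i) - average g s y)
    <= m%:R * (2 * M / N.+1%:R).
Proof.
move=> is' rr ym; have ma0 : 0 <= m%:R * a by rewrite mulr_ge0.
case: sg; rewrite ?expr0 ?mul1r.
  rewrite expr1 mulN1r scaleNr enorm_distC -{1}[y](subrK ((m%:R * a) *: delta_mx 0 i)).
  apply: average_grid_steps rr _ => //.
  rewrite addrAC; have := enormD (y - b) (- ((m%:R * a) *: delta_mx 0 i)).
  by rewrite enormN enormZ enorm_delta mulr1 ger0_norm //; lra.
by apply: average_grid_steps rr _ => //; lra.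
Qed.

(** Increments are controlled along grid steps only, so each coordinate of [w] is rounded to a
    multiple of [a], towards 0 in order not to increase the norm. Of the margin [3 * enorm w], one
    part is for the coordinate path and two are for a signed step. *)
Lemma average_round y w rho' : 0 < a ->
  rho' + (p%:R + 1) * e <= rho -> enorm (y - b) + 3 * enorm w <= rho' ->
  exists w', [/\ forall i, `|w ord0 i - w' ord0 i| <= a, enorm w' <= enorm w &
    enorm (average g (enum 'I_p) (y + w') - average g (enum 'I_p) y) <=
      p%:R * (enorm w * (2 * M / e))].
Proof.
move=> a_gt0 rr yw.
have M0 : 0 <= M.
  have e0 : 0 <= e by rewrite mulr_ge0.
  have : 0 <= (p%:R + 1) * e by rewrite mulr_ge0 ?addr_ge0.
  have := enorm_ge0 w; have := enorm_ge0 (g y); move=> ? ? ?.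
  by apply: le_trans (enorm_ge0 (g y)) (gM _); lra.
have e_gt0 : 0 < e by rewrite mulr_gt0.
pose m i := Num.truncn (`|w ord0 i| / a).
pose w' : 'rV[R]_p := \row_i ((-1) ^+ (w ord0 i < 0)%R * ((m i)%:R * a)).
have mw i : (m i)%:R * a <= `|w ord0 i| /\ `|w ord0 i| < (m i)%:R * a + a.
  have /andP[] := truncn_itv (divr_ge0 (normr_ge0 (w ord0 i)) a0).
  by rewrite ler_pdivlMr // ltr_pdivrMr // -natr1 mulrDl mul1r.
have w'E i : w' ord0 i = (-1) ^+ (w ord0 i < 0)%R * ((m i)%:R * a) by rewrite mxE.
have w'n i : `|w' ord0 i| = (m i)%:R * a.
  by rewrite w'E normrM normrX normrN1 expr1n mul1r ger0_norm ?mulr_ge0.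
have w'w : enorm w' <= enorm w.
  by apply: ler_enorm => i; rewrite w'n; have [] := mw i.
exists w'; split=> // [i|].
  have [lo hi] := mw i; rewrite w'E; case: ltrP => wi.
    by rewrite ltr0_norm // in lo hi; rewrite expr1 mulN1r ler_norml; lra.
  by rewrite ger0_norm // in lo hi; rewrite expr0 mul1r ler_norml; lra.
set s := enum 'I_p; pose Y k := average g s (y + truncate w' k).
have -> : average g s (y + w') - average g s y = \sum_(k < p) (Y k.+1 - Y k).
  rewrite -(big_mkord xpredT (fun k => Y k.+1 - Y k)) telescope_sumr //.
  by rewrite /Y truncate0 truncate_full addr0.
apply: le_trans (enorm_sum _ _) _.
apply: (@le_trans _ _ (\sum_(k < p) enorm w * (2 * M / e))); last first.
  by rewrite sumr_const card_ord -[leLHS]mulr_natl.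
apply: ler_sum => k _.
have [lo hi] := mw k; have wk := coord_le_enorm w k.
rewrite /Y truncateS addrA w'E.
apply: (@le_trans _ _ ((m k)%:R * (2 * M / N.+1%:R))).
  apply: (average_signed_steps _ (rho' := rho')); first by rewrite mem_enum.
    by rewrite size_enum_ord.
  have tw : enorm (truncate w' k) <= enorm w.
    apply: le_trans w'w; apply: ler_enorm => i; rewrite mxE; case: ifP => // _.
    by rewrite normr0.
  rewrite addrAC; have := enormD (y - b) (truncate w' k); lra.
have -> : (m k)%:R * (2 * M / N.+1%:R) = ((m k)%:R * a) * (2 * M / e).
  by rewrite /e; field; rewrite gt_eqF // addrC natr1 pnatr_eq0.
by apply: ler_wpM2r; [rewrite divr_ge0 ?mulr_ge0 // ltW|lra].
Qed.

End Bounded.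
End Grid.
End Averaging.

(** * Existence of a zero *)

Section ZeroExists.
Variables (R : realType) (p : nat).
Implicit Types (g : 'rV[R]_p -> 'rV[R]_p).

(** Uniform continuity in which only [x] is confined to [K]: continuity holds in the ambient space,
    so [z] may leave [K]. *)
Lemma uniform_modulus g (K : set 'rV[R]_p) (d : R) :
  compact K -> (forall z, K z -> {for z, continuous g}) -> 0 < d ->
  exists2 e : R, 0 < e &
    forall x z, K x -> enorm (z - x) < e -> enorm (g z - g x) < d.
Proof.
move=> cK cg d0.
pose P (e : R) (x : 'rV[R]_p) := forall z, enorm (z - x) < e -> enorm (g z - g x) < d.
have : \forall e \near 0^'+, K `<=` P e.
  apply: (compact_near_coveringP K).1 => // x Kx.
  have d20 : 0 < d / 2 / p.+1%:R by rewrite !divr_gt0.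
  have small w : `|w| < d / 2 / p.+1%:R -> enorm (w : 'rV[R]_p) < d / 2.
    rewrite ltr_pdivlMr // => wd; apply: le_lt_trans (enorm_le_norm _) _.
    by apply: le_lt_trans wd; rewrite mulrC ler_wpM2l // ler_nat.
  have /continuous_atP/(_ _ d20)[e e0 He] := cg x Kx.
  exists (ball x (e / 2), [set s | s < e / 2]) => /=.
    split; first by apply: nbhsx_ballx; rewrite divr_gt0.
    by apply: nbhs_right_lt; rewrite divr_gt0.
  move=> [y s] [/=]; rewrite -ball_normE /= => xy se z zy.
  have zy' : `|y - z| < e / 2.
    by rewrite distrC; apply: le_lt_trans (norm_le_enorm _) _; apply: lt_trans se.
  have xz : `|x - z| < e by apply: le_lt_trans (ler_distD y x z) _; lra.
  have -> : g z - g y = (g x - g y) - (g x - g z) by rewrite opprB [RHS]addrC addrA subrK.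
  apply: le_lt_trans (enormD _ _) _; rewrite enormN [ltRHS]splitr.
  by apply: ltrD; apply: small; apply: He => //; lra.
move=> H; near (0:R)^'+ => e; have KP : K `<=` P e by near: e.
by exists e => // x z /KP; apply.
Unshelve. all: by end_near. Qed.

(* The average [gN] of [g] over a fine grid of small cubes inherits the lower
   bounds on directional slopes, and varies at a bounded rate [L] down to the
   scale [t]. An almost minimum [ys] of [enorm gN] then contradicts the existence
   of a direction of descent, unless [g] has a zero. *)
Lemma zero_exists g (b : 'rV[R]_p) (r c r1 : R) :
  0 < c -> (forall z, eball b r z -> {for z, continuous g}) ->
  (forall y y', eball b r y -> eball b r y' ->
    c * enorm (y - y') <= enorm (g y - g y')) ->
  (forall u : 'rV[R]_p, u != 0 -> exists2 v : 'rV[R]_p, enorm v = 1 &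
    forall y (t : R), 0 <= t -> eball b r y -> eball b r (y + t *: v) ->
      c * enorm u * t <= dot u (g (y + t *: v) - g y)) ->
  0 < r1 -> r1 < r -> enorm (g b) < c * r1 / 16 ->
  exists2 y, enorm (y - b) < r1 & g y = 0.
Proof.
move=> c0 cg expand slope r10 r1r gb.
apply: contrapT => noy.
pose cl s := [set z : 'rV[R]_p | enorm (z - b) <= s].
have ccl s : compact (cl s) by apply: closed_eball_compact.
have clb s : 0 <= s -> cl s b by move=> s0; rewrite /cl /= subrr enorm0.
(* Averages centred within [r1] of [b] use values of [g] as far as [r2], on a compact ball where [g]
   is continuous. *)
pose r2 := (r1 + r) / 2.
have r2r s z : s <= r2 -> cl s z -> eball b r z.
  by move=> sr zs; rewrite /eball /=; apply: le_lt_trans zs _; rewrite /r2 in sr; lra.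
have r12 : r1 < r2 by rewrite /r2; lra.
have ceg s : s <= r2 -> {within cl s, continuous (fun z => enorm (g z))}.
  move=> sr; apply: continuous_in_subspaceT => z /set_mem zs.
  apply: (@continuous_comp _ _ _ g (@enorm R p)); last exact: enorm_continuous.
  exact: cg (r2r s z sr zs).
have r20 : 0 < r2 by rewrite /r2; lra.
have [zM _ gM] := EVT_max_rV (ex_intro _ b (clb r2 (ltW r20))) (ccl r2) (ceg r2 (lexx _)).
pose M := enorm (g zM) + 1.
have {}gM z : enorm (z - b) <= r2 -> enorm (g z) <= M.
  by move=> zr; have := gM z (mem_set zr); rewrite /M; lra.
have M0 : 0 < M by rewrite /M; have := enorm_ge0 (g zM); lra.
have [zm /set_mem zmr gm] :=
  EVT_min_rV (ex_intro _ b (clb r1 (ltW r10))) (ccl r1) (ceg r1 (ltW r12)).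
pose m := enorm (g zm).
have {}gm z : enorm (z - b) <= r1 -> m <= enorm (g z).
  by move=> zr; have := gm z (mem_set zr).
have far z : enorm (z - b) <= r1 -> c * enorm (z - b) - c * r1 / 16 <= enorm (g z).
  move=> zr; have := expand z b (r2r r1 z (ltW r12) zr) (r2r r1 b (ltW r12) (clb r1 (ltW r10))).
  by have := enormD (g z) (- g b); rewrite enormN; lra.
have cr1 : 0 < c * r1 by rewrite mulr_gt0.
have m0 : 0 < m.
  apply: enorm_gt0; apply/eqP => gzm; apply: noy; exists zm => //.
  rewrite lt_neqAle zmr andbT; apply/eqP => E.
  by have := far zm zmr; rewrite gzm enorm0 E; lra.
(* Tolerance between [gN] and [g]: the first bound keeps [enorm gN] above [m / 2], the second
   preserves the contrast between the centre and the outer half of the ball. *)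
pose d := Num.min (m / 2) (c * r1 / 16).
have d0 : 0 < d by rewrite lt_min; apply/andP; split; lra.
have [dm dc] : d <= m / 2 /\ d <= c * r1 / 16 by rewrite !ge_min !lexx orbT.
have cg2 z : cl r2 z -> {for z, continuous g} by move=> zr; apply: cg (r2r r2 z (lexx _) zr).
have [e1 e10 ge1] := uniform_modulus (ccl r2) cg2 d0.
have p0 : 0 <= p%:R :> R by [].
(* The averages sample at distance at most [p e]: within the modulus [e1], and inside the ball of
   radius [r2]. *)
pose e := Num.min e1 (r2 - r1) / (2 * (p%:R + 1)).
have min0 : 0 < Num.min e1 (r2 - r1) by rewrite lt_min e10 subr_gt0.
have e0 : 0 < e by rewrite divr_gt0 // mulr_gt0 //; lra.
have pe : 2 * ((p%:R + 1) * e) = Num.min e1 (r2 - r1).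
  by rewrite /e mulrA mulrC divfK // gt_eqF // mulr_gt0 //; lra.
have [pe1 pe2] : 2 * ((p%:R + 1) * e) <= e1 /\ 2 * ((p%:R + 1) * e) <= r2 - r1.
  by rewrite pe !ge_min !lexx orbT.
have pe0 : 0 <= p%:R * e by rewrite mulr_ge0 // ltW.
pose L := p%:R * (2 * M / e) + 1.
have L0 : 0 < L.
  by rewrite ltr_wpDl // mulr_ge0 // divr_ge0 ?mulr_ge0 // ltW.
(* The three bounds keep [ys + w] in the ball, place [ys] in its inner half, and make the descent,
   at least [c m t >= 8 (L t)^2], exceed the errors, which total [5 (L t)^2]. *)
pose t := Num.min (r1 / 8) (Num.min (c * r1 / (4 * L)) (c * m / (8 * L ^+ 2))).
have t0 : 0 < t.
  rewrite !lt_min divr_gt0 //= !divr_gt0 // ?mulr_gt0 // ?exprn_gt0 //.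
have [tr [tL tLL]] : t <= r1 / 8 /\ L * t <= c * r1 / 4 /\ 8 * (L * t) ^+ 2 <= c * m * t.
  have [t1 [t2 t3]] : t <= r1 / 8 /\ t <= c * r1 / (4 * L) /\ t <= c * m / (8 * L ^+ 2).
    by rewrite /t !ge_min !lexx !orbT.
  split=> //; split.
    by move: t2; rewrite ler_pdivlMr ?mulr_gt0 //; lra.
  move: t3; rewrite ler_pdivlMr ?mulr_gt0 ?exprn_gt0 // => t3.
  by have := ler_wpM2r (ltW t0) t3; rewrite exprMn; lra.
have Lt0 : 0 < L * t by rewrite mulr_gt0.
have [e2 e20 ge2] := uniform_modulus (ccl r2) cg2 Lt0.
(* The mesh comes last: it depends on [t] through [e2], while [L] does not depend on it. The
   remainder of the rounding then changes [g] by less than [L t]. *)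
pose N := Num.truncn ((p%:R + 1) * e / e2).
pose a := e / N.+1%:R.
have a0 : 0 < a by rewrite divr_gt0.
have Na : N.+1%:R * a = e by rewrite /a mulrC divfK // pnatr_eq0.
have ae2 : p%:R * a < e2.
  have : (p%:R + 1) * e / e2 < N.+1%:R.
    by have /andP[] := truncn_itv (divr_ge0 (mulr_ge0 (addr_ge0 p0 ler01) (ltW e0)) (ltW e20)).
  rewrite ltr_pdivrMr // -Na => H.
  have : (p%:R + 1) * a < e2.
    by rewrite -(ltr_pM2l (ltr0Sn R N)) mulrCA.
  lra.
pose gN := average N a g (enum 'I_p).
have se : (size (enum 'I_p))%:R * (N.+1%:R * a) = p%:R * e by rewrite Na size_enum_ord.
have gNg y : enorm (y - b) <= r1 -> enorm (gN y - g y) <= d.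
  move=> yr; apply: average_enorm_le (ltW a0) _ _ _ _ _ _ => z; rewrite se => zy.
  by apply/ltW/ge1; [rewrite /cl /=; lra|lra].
pose Q y := enorm (gN y) ^+ 2.
pose S := [set Q y | y in cl r1].
have S0 : has_inf S.
  split; first by exists (Q b), b => //; apply: clb (ltW r10).
  by exists 0 => _ [y _ <-]; apply: sqr_ge0.
(* An almost minimum is enough if its slack is of the order of the other errors. *)
have eps0 : 0 < (L * t) ^+ 2 by rewrite exprn_gt0.
have [_ [ys ysr <-] Qys] := inf_adherent eps0 S0.
have {}Qys y : cl r1 y -> Q ys < Q y + (L * t) ^+ 2.
  move=> yr; apply: lt_le_trans Qys _; rewrite lerD2r.
  by apply: ge_inf; [exact: S0.2|exists y].
have gN_far y : enorm (y - b) <= r1 -> enorm (g y) - d <= enorm (gN y).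
  move=> yr; have := gNg y yr; rewrite enorm_distC.
  by have := enormD (g y - gN y) (gN y); rewrite subrK; lra.
(* Otherwise [gN] has norm at least [3/8 c r1] at [ys] and at most [1/8 c r1] at [b], which would
   require [9/64 < 1/64 + 4/64]. The 16 in the bound on [g b] leaves room for this. *)
have ysr2 : enorm (ys - b) < r1 / 2.
  rewrite ltNge; apply/negP => ysr2.
  have h1 : c * r1 * 3 / 8 <= enorm (gN ys).
    have := far ys ysr; have := gN_far ys ysr.
    by have := ler_wpM2l (ltW c0) ysr2; lra.
  have h2 : enorm (gN b) <= c * r1 / 8.
    have br : enorm (b - b) <= r1 by apply: (clb r1 (ltW r10)).
    have := gNg b br; have := enormD (gN b - g b) (g b); rewrite subrK; lra.
  have := Qys b (clb r1 (ltW r10)); rewrite /Q.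
  have h3 : (c * r1 * 3 / 8) ^+ 2 <= enorm (gN ys) ^+ 2.
    by rewrite ler_pXn2r ?nnegrE ?enorm_ge0 //; lra.
  have h4 : enorm (gN b) ^+ 2 <= (c * r1 / 8) ^+ 2.
    by rewrite ler_pXn2r ?nnegrE ?enorm_ge0 //; lra.
  have h5 : (L * t) ^+ 2 <= (c * r1 / 4) ^+ 2.
    by rewrite ler_pXn2r ?nnegrE ?(ltW Lt0) //; lra.
  have h6 : 0 < (c * r1) ^+ 2 by rewrite exprn_gt0.
  rewrite !exprMn in h3 h4 h5 h6 *; lra.
pose u := gN ys.
have um : m / 2 <= enorm u by have := gN_far ys ysr; have := gm ys ysr; rewrite /u; lra.
have u0 : u != 0 by apply/eqP => E; move: um; rewrite E enorm0; lra.
have [v v1 Hv] := slope u u0.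
pose w := - (t *: v).
have wt : enorm w = t by rewrite /w enormN enormZ v1 mulr1 gtr0_norm.
have nearw x q : enorm (x - b) + enorm q <= r2 -> cl r2 (x + q).
  by rewrite /cl /= addrAC; apply: le_trans (enormD _ _).
pose D := gN (ys + w) - gN ys.
(* Although [u] is a value of [gN] and not of [g], the direction [v] serves every base point, hence
   every term of the average; the slope bound runs from [z + w] to [z]. *)
have Du : dot u D <= - (c * enorm u * t).
  suff : c * enorm u * t <= dot (- u) D by rewrite dotNl; lra.
  rewrite /D -average_translateB; apply: average_dot_ge (ltW a0) _ _ _ _ _ _ => z.
  rewrite se => zys.
  have zb : enorm (z - b) <= r1 / 2 + p%:R * e.
    have := enormD (z - ys) (ys - b); rewrite addrA subrK; lra.
  rewrite dotNl -dotNr opprB.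
  have := Hv (z + w) t (ltW t0); rewrite {1 2}/w !subrK -/w; apply.
    by apply: (r2r r2) => //; apply: nearw; rewrite wt; lra.
  by apply: (r2r r2) => //; rewrite /cl /=; lra.
(* Along the grid to [ys + w'] at rate [L], then to [ys + w] by the modulus [e2]; each part costs at
   most [L t]. *)
have DL : enorm D <= 2 * (L * t).
  have [||w' [ww' w'w Dw']] := @average_round R p N a (ltW a0) g b M r2 gM ys w r1 a0.
  - by rewrite Na; lra.
  - by rewrite wt; lra.
  have -> : D = (gN (ys + w' + (w - w')) - gN (ys + w')) + (gN (ys + w') - gN ys).
    by rewrite /D addrA subrK -addrA (addrC w') subrK.
  apply: le_trans (enormD _ _) _.
  have h1 : enorm (gN (ys + w') - gN ys) <= L * t.
    apply: le_trans Dw' _; rewrite wt Na mulrCA mulrC ler_wpM2r ?(ltW t0) //.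
    by rewrite /L; lra.
  have h2 : enorm (gN (ys + w' + (w - w')) - gN (ys + w')) <= L * t.
    rewrite -average_translateB -[X in enorm X]subr0.
    apply: average_enorm_le (ltW a0) _ _ _ _ _ _ => z; rewrite se subr0 => zys.
    apply/ltW/ge2.
      have := enormD (z - (ys + w')) (ys - b); have := nearw; rewrite /cl /= => _.
      have := enormD (z - (ys + w') + (ys - b)) w'.
      have -> : z - (ys + w') + (ys - b) + w' = z - b.
        by apply/rowP => i; rewrite !mxE; ring.
      lra.
    rewrite addrC addKr; apply: le_lt_trans ae2.
    apply: le_trans (enorm_le_norm _) _; rewrite ler_wpM2l //.
    apply: norm_le_coord => [|i j]; first exact: ltW.
    by rewrite (ord1 i); apply: le_trans (ww' j); rewrite [(w - w') _ _]mxE [(- w') _ _]mxE.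
  lra.
have ys1 : cl r1 (ys + w).
  by rewrite /cl /= addrAC; have := enormD (ys - b) w; rewrite wt; lra.
have := Qys _ ys1; rewrite /Q -/u.
have -> : gN (ys + w) = u + D by rewrite /D /u [RHS]addrC subrK.
rewrite sqr_enormD.
have D2 : enorm D ^+ 2 <= 4 * (L * t) ^+ 2.
  rewrite (_ : 4 * _ = (2 * (L * t)) ^+ 2); last by ring.
  by rewrite ler_pXn2r ?nnegrE ?enorm_ge0 // mulr_ge0 // ltW.
have : c * m * t <= 2 * (c * enorm u * t).
  rewrite mulrA ler_pM2r // mulrCA ler_pM2l //; lra.
lra.
Unshelve. all: by end_near. Qed.


End ZeroExists.

(** * Consequences of the bound on the convex hull *)

Section Hull.
Variables (R : realType) (p : nat).

Lemma sigma_bound (A : 'M[R]_p) (c : R) : (c%:E <= sigma A)%E ->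
  forall v, c * enorm v <= enorm (v *m A^T).
Proof.
move=> cA v; have [->|v0] := eqVneq v 0; first by rewrite mul0mx enorm0 mulr0.
have nv := enorm_gt0 v0.
have : ((c%:E : \bar R) <= (enorm ((enorm v)^-1 *: v *m A^T))%:E)%E.
  apply: le_trans cA _; apply: ereal_inf_lbound; exists ((enorm v)^-1 *: v) => //=.
  by rewrite enormZ ger0_norm ?invr_ge0 ?enorm_ge0 // mulVf // gt_eqF.
rewrite lee_fin -scalemxAl enormZ ger0_norm ?invr_ge0 ?enorm_ge0 //.
by rewrite ler_pdivlMl // mulrC.
Qed.

(** The bound makes [A^T] invertible, so [u = v *m A^T] for some [v], and [|u|^2 = dot (u *m A) v <=
    |u *m A| |v| <= |u *m A| |u| / c]. *)
Lemma transpose_bound (A : 'M[R]_p) (c : R) : 0 < c ->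
  (forall v, c * enorm v <= enorm (v *m A^T)) ->
  forall u, c * enorm u <= enorm (u *m A).
Proof.
move=> c0 cA u; have [->|u0] := eqVneq u 0; first by rewrite mul0mx enorm0 mulr0.
have uA : A^T \in unitmx.
  rewrite -row_free_unit; apply: inj_row_free => v vA.
  apply/enorm_eq0/eqP; rewrite eq_le enorm_ge0 andbT -(ler_pM2l c0) mulr0.
  by apply: le_trans (cA v) _; rewrite vA enorm0.
pose v := u *m invmx A^T.
have vA : v *m A^T = u by rewrite mulmxKV.
have := cA v; rewrite vA => cv.
have : enorm u ^+ 2 <= enorm (u *m A) * enorm v.
  rewrite sqr_enorm -{2}vA dot_mulmx; exact: cauchy_schwarz.
move=> uu; rewrite -(ler_pM2r (enorm_gt0 u0)) -mulrA -expr2.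
apply: (@le_trans _ _ (c * (enorm (u *m A) * enorm v))); first by rewrite ler_pM2l.
by rewrite mulrCA ler_wpM2l // enorm_ge0.
Qed.

Lemma convex_hull_segment (S : set 'M[R]_p) A B (t : R) : 0 <= t <= 1 ->
  convex_hull S A -> convex_hull S B -> convex_hull S (A + t *: (B - A)).
Proof.
move=> /andP[t0 t1] SA SB M [/= cM SM].
have -> : A + t *: (B - A) = t *: B + (1 - t) *: A.
  by rewrite scalerBl scale1r scalerBr addrCA.
exact: set_mem (cM B A (Itv01 t0 t1) (mem_set (SB M (conj cM SM))) (mem_set (SA M (conj cM SM)))).
Qed.

Variable D : o_minimal_structure R.
Variables (g g' : 'rV[R]_p -> 'rV[R]_p) (b : 'rV[R]_p) (r c : R).
Hypothesis dg : dfun D g'.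
Hypothesis cg : forall z, eball b r z -> {for z, continuous g'}.
Hypothesis gg : forall z, eball b r z -> g z = g' z.
Hypothesis c0 : 0 < c.
Hypothesis hull_bound : forall A, convex_hull (derivatives g (eball b r)) A ->
  forall v, c * enorm v <= enorm (v *m A^T).

Let mvi (u v : 'rV[R]_p) (k : R) :
  (forall A, convex_hull (derivatives g (eball b r)) A -> k <= dot u (v *m A^T)) ->
  forall y (t : R), 0 <= t -> eball b r y -> eball b r (y + t *: v) ->
    k * t <= dot u (g' (y + t *: v) - g' y).
Proof.
move=> kA y t t0 yb ytb; rewrite -!gg //.
apply: (mean_value_inequality dg (@eball_open _ _ b r)) => //.
  by move=> ? ? ? ? ? ?; apply: eball_convex.
move=> z zb C1z; rewrite -[jacobian g z]trmxK; apply: kA.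
by apply: sub_gen_smallest; exists z => //; split=> // nC1.
Qed.

(** For [v = y - y'] the image of the hull under [A |-> v *m A^T] is convex and avoids the ball of
    radius [c * enorm v]. The separating unit vector [u] gives the bound to be integrated from [y']
    to [y], and Cauchy-Schwarz removes [u]. *)
Lemma expanding y y' : eball b r y -> eball b r y' ->
  c * enorm (y - y') <= enorm (g' y - g' y').
Proof.
move=> yb yb'; have [->|yy] := eqVneq y y'; first by rewrite !subrr enorm0 mulr0.
set v := y - y'; have nv : 0 < enorm v by rewrite enorm_gt0 // subr_eq0.
have [|||x [A SA <-]|u u1 Hu] := @convex_separation R p
  [set v *m A^T | A in convex_hull (derivatives g (eball b r))] (c * enorm v)
  ((enorm v)^-1 *: v).
- by rewrite enormZ ger0_norm ?invr_ge0 ?enorm_ge0 // mulVf // gt_eqF.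
- by rewrite mulr_gt0.
- move=> _ _ t t01 [A SA <-] [B SB <-].
  exists (A + t *: (B - A)); first exact: convex_hull_segment.
  by rewrite linearD linearZ linearB /= mulmxDr -scalemxAr mulmxBr.
- exact: hull_bound.
have := @mvi u v (c * enorm v) (fun A SA => Hu _ (ex_intro2 _ _ A SA erefl)) y' 1 ler01 yb'.
rewrite scale1r mulr1 {2 3}/v subrKC => /(_ yb) H; apply: le_trans H _.
by apply: le_trans (cauchy_schwarz _ _) _; rewrite u1 mul1r.
Qed.

(** The dual separation, of the image of the hull under [A |-> u *m A], by means of the bound for
    the transposes. *)
Lemma descent_direction (u : 'rV[R]_p) : u != 0 ->
  exists2 v : 'rV[R]_p, enorm v = 1 &
  forall y (t : R), 0 <= t -> eball b r y -> eball b r (y + t *: v) ->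
    c * enorm u * t <= dot u (g' (y + t *: v) - g' y).
Proof.
move=> u0; have nu := enorm_gt0 u0.
have [|||x [A SA <-]|v v1 Hv] := @convex_separation R p
  [set u *m A | A in convex_hull (derivatives g (eball b r))] (c * enorm u)
  ((enorm u)^-1 *: u).
- by rewrite enormZ ger0_norm ?invr_ge0 ?enorm_ge0 // mulVf // gt_eqF.
- by rewrite mulr_gt0.
- move=> _ _ t t01 [A SA <-] [B SB <-].
  exists (A + t *: (B - A)); first exact: convex_hull_segment.
  by rewrite mulmxDr -scalemxAr mulmxBr.
- by apply: transpose_bound => //; apply: hull_bound.
exists v => // y t t0 yb ytb; apply: mvi => // A SA.
by rewrite dot_mulmx dotC; apply: Hv; exists A.
Qed.

End Hull.

(** The infimum is nonnegative, so if it were positive for no [r] in []0, r0[] it would vanish near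
    0, and so would its limit. *)
Lemma inf_sigma_gt0 (R : realType) (n p : nat)
    (F : 'rV[R]_n * 'rV[R]_p -> 'rV[R]_p) (xbar : 'rV[R]_n) (ybar : 'rV[R]_p) (r0 : R) :
  0 < r0 -> (0 < lim (inf_sigma F xbar ybar r @[r --> 0^'+]))%E ->
  exists r c : R, [/\ 0 < r, r < r0, 0 < c & (c%:E <= inf_sigma F xbar ybar r)%E].
Proof.
move=> r00 lim0.
have inf_ge0 r : (0 <= inf_sigma F xbar ybar r)%E.
  apply/ereal_infP => _ [A _ <-]; apply/ereal_infP => _ [v _ <-].
  by rewrite lee_fin enorm_ge0.
have [r [rr r_gt0]] : exists r, (0 < r < r0) /\ (0 < inf_sigma F xbar ybar r)%E.
  apply: contrapT => nor; move: lim0.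
  rewrite (@lim_near_cst _ (@ereal_hausdorff R) _ _ _ 0%E) ?ltxx //.
  near=> r; apply/eqP; rewrite eq_le inf_ge0 andbT leNgt; apply/negP => inf0.
  apply: nor; exists r; split=> //; apply/andP; split; near: r.
    exact: nbhs_right_gt.
  exact: nbhs_right_lt.
have /andP[r1 r2] := rr.
(* An infimum [+oo] admits any constant [c]. *)
exists r; case: (inf_sigma F xbar ybar r) r_gt0 => [c|_|//]; last first.
  by exists 1; split=> //; rewrite leey.
by rewrite lte_fin => c0; exists c.
Unshelve. all: by end_near. Qed.

(** * The implicit function *)

Section Coding.
Variables (R : realType) (D : o_minimal_structure R).

Lemma definable2P n p (A : set ('rV[R]_n * 'rV[R]_p)) :
  definable2 D A <-> dpred D (fun z : 'rV[R]_n * 'rV[R]_p => A z).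
Proof.
rewrite /definable2 /dpred; suff -> : @concat R n p @` A =
    [set y | A (lsubmx y, rsubmx y)] by [].
apply/seteqP; split=> y /=.
  by move=> [[u v] Auv <-]; rewrite /concat /= row_mxKl row_mxKr.
by move=> Ay; exists (lsubmx y, rsubmx y) => //; rewrite /concat /= hsubmxK.
Qed.

Lemma definable_map2P n p q (A : set ('rV[R]_n * 'rV[R]_p))
    (F : 'rV[R]_n * 'rV[R]_p -> 'rV[R]_q) :
  definable_map2 D A F <->
  dpred D (fun w : 'rV[R]_n * 'rV[R]_p * 'rV[R]_q => A w.1 /\ F w.1 = w.2).
Proof.
rewrite /definable_map2 /dpred.
suff -> : [set concat (concat z, F z) | z in A] =
    [set y | A (lsubmx (lsubmx y), rsubmx (lsubmx y)) /\
      F (lsubmx (lsubmx y), rsubmx (lsubmx y)) = rsubmx y] by [].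
apply/seteqP; split=> y /=.
  by move=> [[u v] Auv <-]; rewrite /concat /= !row_mxKl !row_mxKr.
move=> [Ay Fy]; exists (lsubmx (lsubmx y), rsubmx (lsubmx y)) => //.
by rewrite /concat Fy /= !hsubmxK.
Qed.

Lemma definable_mapP n p (A : set 'rV[R]_n) (f : 'rV[R]_n -> 'rV[R]_p) :
  definable_map D A f <->
  dpred D (fun z : 'rV[R]_n * 'rV[R]_p => A z.1 /\ f z.1 = z.2).
Proof.
rewrite /definable_map /dpred.
suff -> : [set concat (x, f x) | x in A] =
    [set y | A (lsubmx y) /\ f (lsubmx y) = rsubmx y] by [].
apply/seteqP; split=> y /=.
  by move=> [u Au <-]; rewrite /concat /= !row_mxKl !row_mxKr.
by move=> [Ay fy]; exists (lsubmx y) => //; rewrite /concat fy /= hsubmxK.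
Qed.

Lemma dpred_eball T (cT : chart R T) n (a : 'rV[R]_n) (r : R) (f : T -> 'rV[R]_n) :
  dfun D f -> dpred D (fun x => eball a r (f x)).
Proof.
(* The formula compares squares, which needs a positive radius; otherwise the ball is empty. *)
move=> df; have [r0|r0] := lerP r 0.
  apply: eq_dpred (dpred_cst D False) => x; split=> //.
  by rewrite /eball /= => /lt_le_trans/(_ r0); rewrite ltNge enorm_ge0.
have : dpred D (fun x => \sum_i (f x ord0 i + - a ord0 i) * (f x ord0 i + - a ord0 i)
    < r ^+ 2).
  apply: dpred_lt; last exact: dfun_cst.
  by apply: dfun_sum => i; definability.
apply: eq_dpred => x.
rewrite /eball /=.
have -> : (enorm (f x - a) < r) = (enorm (f x - a) ^+ 2 < r ^+ 2).
  by rewrite ltr_pXn2r ?nnegrE ?enorm_ge0 // ltW.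
rewrite sqr_enorm dotE (eq_bigr (fun i =>
  (f x - a) ord0 i * (f x - a) ord0 i)) // => i _.
by rewrite !mxE.
Qed.

Lemma pair_continuous n p (x : 'rV[R]_n) :
  continuous (fun y : 'rV[R]_p => (x, y)).
Proof.
move=> y; apply/continuous_atP => e e0; exists e => // z yz.
by rewrite prod_normE /= subrr normr0 gt_max e0.
Qed.

Lemma pair_continuousl n p (y : 'rV[R]_p) :
  continuous (fun x : 'rV[R]_n => (x, y)).
Proof.
move=> x; apply/continuous_atP => e e0; exists e => // z xz.
by rewrite prod_normE /= subrr normr0 gt_max e0 andbT.
Qed.

Lemma near_eq_continuous (V W : normedModType R) (f h : V -> W) (A : set V) z :
  open A -> A z -> {in A, f =1 h} -> {for z, continuous f} -> {for z, continuous h}.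
Proof.
move=> oA Az fh /continuous_atP cf; apply/continuous_atP => e e0.
have [d d0 Hd] := cf e e0.
have /nbhs_ballP[d' /= d'0 Hd'] := open_nbhs_nbhs (conj oA Az).
exists (Num.min d d'); first by rewrite lt_min d0.
move=> z'; rewrite lt_min => /andP[zd zd'].
have Az' : A z' by apply: Hd'; rewrite -ball_normE.
by rewrite -!fh ?inE //; apply: Hd.
Qed.

End Coding.

Theorem theorem4p3 (R : realType) (D : o_minimal_structure R) (n p : nat)
    (Omega : set ('rV[R]_n * 'rV[R]_p))
    (F : 'rV[R]_n * 'rV[R]_p -> 'rV[R]_p)
    (xbar : 'rV[R]_n) (ybar : 'rV[R]_p)
    (Omega_open : open Omega) (Omega_def : definable2 D Omega)
    (F_cont : {within Omega, continuous F}) (F_def : definable_map2 D Omega F)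
    (Omega_bar : Omega (xbar, ybar)) (F_bar : F (xbar, ybar) = 0)
    (F_sigma : (0 < lim (inf_sigma F xbar ybar r @[r --> 0^'+]))%E) :
  exists (U : set 'rV[R]_n) (V : set 'rV[R]_p),
    [/\ open U, definable D U & U xbar] /\
    [/\ open V, definable D V & V ybar] /\
    U `*` V `<=` Omega /\
    exists2 G : 'rV[R]_n -> 'rV[R]_p,
      implicit_map D F xbar ybar U V G &
      forall G' : 'rV[R]_n -> 'rV[R]_p,
        implicit_map D F xbar ybar U V G' -> {in U, G' =1 G}.
Proof.
have /nbhs_ballP[r0 /= r00 ballO] := open_nbhs_nbhs (conj Omega_open Omega_bar).
have [r [c [r_gt0 rr0 c0 cinf]]] := inf_sigma_gt0 r00 F_sigma.
have inO x y : eball xbar r x -> eball ybar r y -> Omega (x, y).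
  move=> xr yr; apply: ballO; split; rewrite /= -ball_normE /= distrC;
    apply: le_lt_trans (norm_le_enorm _) _.
    exact: lt_trans xr rr0.
  exact: lt_trans yr rr0.
(* Extension by 0 gives a total definable function, still continuous at the points of the open set
   [Omega]. *)
pose F' z := if `[< Omega z >] then F z else 0.
have F'E z : Omega z -> F' z = F z by rewrite /F' => /asboolP ->.
have dF' : dfun D F'.
  have dO := (definable2P D Omega).1 Omega_def.
  have dG := (definable_map2P D Omega F).1 F_def.
  have : dpred D (fun w : 'rV[R]_n * 'rV[R]_p * 'rV[R]_p =>
      (Omega w.1 /\ F w.1 = w.2) \/ (~ Omega w.1 /\ w.2 = 0)).
    apply: dpred_or => //; apply: dpred_and; last by definability.
    by apply: dpred_not; apply: (dpred_comp (f := fst)) dO; definability.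
  apply: eq_dpred => -[z w] /=; rewrite /F'; split=> [[[/asboolP -> //]|[/asboolPn/negbTE -> ->//]]|].
  case: asboolP => Oz E; [left|right]; split=> //.
have F'c z : Omega z -> {for z, continuous F'}.
  move=> Oz; apply: (near_eq_continuous Omega_open Oz (f := F)).
    by move=> w; rewrite inE => /F'E.
  by move: F_cont; rewrite continuous_open_subspace // => /(_ z); apply; rewrite inE.
pose g x y := F' (x, y).
have dg x : dfun D (g x).
  by apply: (dfun_comp (f := fun y : 'rV[R]_p => (x, y)) dF'); definability.
have cg x z : eball xbar r x -> eball ybar r z -> {for z, continuous (g x)}.
  move=> xr zr; apply: (@continuous_comp _ _ _ (fun y : 'rV[R]_p => (x, y)) F').
    exact: pair_continuous.
  exact/F'c/inO.
have gg x z : eball xbar r x -> eball ybar r z -> F (x, z) = g x z.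
  by move=> xr zr; rewrite /g F'E //; apply: inO.
have hull x : eball xbar r x -> forall A,
    convex_hull (derivatives (fun y => F (x, y)) (eball ybar r)) A ->
    forall v, c * enorm v <= enorm (v *m A^T).
  move=> xr A hA; apply: sigma_bound; apply: le_trans cinf _.
  by apply: ereal_inf_lbound; exists A => //; exists x.
have expand x : eball xbar r x -> forall y y', eball ybar r y -> eball ybar r y' ->
    c * enorm (y - y') <= enorm (g x y - g x y').
  move=> xr; apply: (expanding (dg x)); [by move=> z; apply: cg|by move=> z; apply: gg|by []|].
  exact: hull.
have descend x : eball xbar r x -> forall u : 'rV[R]_p, u != 0 ->
    exists2 v : 'rV[R]_p, enorm v = 1 &
    forall y (t : R), 0 <= t -> eball ybar r y -> eball ybar r (y + t *: v) ->
      c * enorm u * t <= dot u (g x (y + t *: v) - g x y).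
  move=> xr; apply: (descent_direction (dg x)); [by move=> z; apply: cg|by move=> z; apply: gg|by []|].
  exact: hull.
(* The gap between [r1] and [r] leaves [zero_exists] room for averaging. *)
pose r1 := r / 2.
have r10 : 0 < r1 by rewrite divr_gt0.
have r1r : r1 < r by rewrite /r1; lra.
have xbar_r s : 0 < s -> eball xbar s xbar by move=> s0; rewrite /eball /= subrr enorm0.
have ybar_r s : 0 < s -> eball ybar s ybar by move=> s0; rewrite /eball /= subrr enorm0.
have sub1 y : eball ybar r1 y -> eball ybar r y by move=> yr; apply: lt_trans yr r1r.
have [rho [rho0 rhor grho]] : exists rho : R, [/\ 0 < rho, rho <= r &
    forall x, eball xbar rho x -> enorm (g x ybar) < c * r1 / 16].
  have cx : {for xbar, continuous (fun x => enorm (g x ybar))}.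
    apply: (@continuous_comp _ _ _ (fun x => g x ybar) (@enorm R p)); last exact: enorm_continuous.
    apply: (@continuous_comp _ _ _ (fun x : 'rV[R]_n => (x, ybar)) F').
      exact: pair_continuousl.
    exact: F'c.
  have e0 : 0 < c * r1 / 16 by rewrite !(divr_gt0, mulr_gt0).
  have [d d0 Hd] := (continuous_atP _ _).1 cx _ e0.
  exists (Num.min d r); split; first by rewrite lt_min d0.
    by rewrite ge_min lexx orbT.
  move=> x; rewrite /eball /= lt_min => /andP[xd _].
  have := Hd x; rewrite distrC => /(_ (le_lt_trans (norm_le_enorm _) xd)).
  have -> : g xbar ybar = 0 by rewrite /g F'E.
  by rewrite enorm0 sub0r normrN ger0_norm // enorm_ge0.
pose U := eball xbar rho; pose V := eball ybar r1.
have UO x : U x -> eball xbar r x by move=> xU; apply: lt_le_trans xU rhor.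
have unique x y y' : U x -> V y -> V y' -> g x y = 0 -> g x y' = 0 -> y = y'.
  move=> /UO xr /sub1 yV /sub1 yV' gy gy'; apply/eqP; rewrite -subr_eq0; apply/eqP/enorm_eq0.
  have := expand x xr y y' yV yV'; rewrite gy gy' subrr enorm0 pmulr_rle0 // => le0.
  by apply/eqP; rewrite eq_le le0 enorm_ge0.
pose G x := xget ybar [set y | V y /\ g x y = 0].
have GP x : U x -> V (G x) /\ g x (G x) = 0.
  move=> xU; apply: (xgetPex ybar (P := [set y | V y /\ g x y = 0])).
  have xr := UO x xU.
  have [y yV gy] := zero_exists c0 (fun z => cg x z xr) (expand x xr) (descend x xr)
    r10 r1r (grho x xU).
  by exists y.
have FE x y : U x -> V y -> F (x, y) = g x y by move=> /UO xr /sub1 yr; apply: gg.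
have dU : dpred D (fun x : 'rV[R]_n => U x) by apply: dpred_eball; definability.
have dV : dpred D (fun y : 'rV[R]_p => V y) by apply: dpred_eball; definability.
have oU : open U by apply: eball_open.
exists U, V; split; first by split=> //; exact: xbar_r.
split; first by split=> //; [exact: eball_open|exact: ybar_r].
split; first by move=> [x y] [/= /UO xr /sub1 yr]; apply: inO.
exists G; last first.
  move=> G' [G'V _ _ _ G'0] x; rewrite inE => xU; have [GV G0] := GP x xU.
  have G'x : V (G' x) by apply: G'V; exists x.
  by apply: (unique x) => //; rewrite -FE // G'0.
split.
- by move=> _ [x xU <-]; have [] := GP x xU.
(* Expansion of [g x'] bounds [c |G x - G x'|] by the norm of [g x' (G x)], which tends to that of
   [g x (G x) = 0] as [x'] tends to [x]. *)
- rewrite continuous_open_subspace // => x; rewrite inE => xU; have [GV G0] := GP x xU.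
  apply/continuous_atP => e e0.
  have cx : {for x, continuous (fun x' => enorm (g x' (G x)))}.
    apply: (@continuous_comp _ _ _ (fun x' => g x' (G x)) (@enorm R p)); last exact: enorm_continuous.
    apply: (@continuous_comp _ _ _ (fun x' : 'rV[R]_n => (x', G x)) F').
      exact: pair_continuousl.
    by apply/F'c/inO; [exact: UO|exact: sub1].
  have [d d0 Hd] := (continuous_atP _ _).1 cx _ (mulr_gt0 c0 e0).
  have /nbhs_ballP[d' /= d'0 Hd'] := open_nbhs_nbhs (conj oU xU).
  exists (Num.min d d'); first by rewrite lt_min d0.
  move=> x'; rewrite lt_min => /andP[/Hd xd xd'].
  have x'U : U x' by apply: Hd'; rewrite -ball_normE.
  have [GV' G0'] := GP x' x'U.
  apply: le_lt_trans (norm_le_enorm _) _; rewrite -(ltr_pM2l c0).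
  apply: le_lt_trans (expand x' (UO x' x'U) _ _ (sub1 _ GV) (sub1 _ GV')) _.
  by move: xd; rewrite G0 G0' subr0 enorm0 sub0r normrN ger0_norm // enorm_ge0.
- apply/definable_mapP.
  (* By uniqueness the graph of [G] over [U] is the zero set of [F'] in [U x V], so the choice made
     by [xget] does not affect definability. *)
  have : dpred D (fun z : 'rV[R]_n * 'rV[R]_p => (U z.1 /\ V z.2) /\ F' z = 0).
    apply: dpred_and; last by apply: dpred_eq; [exact: dF'|exact: dfun_cst].
    by apply: dpred_and; apply: dpred_eball; definability.
  apply: eq_dpred => -[x y] /=; split=> [[[xU yV] F0]|[xU <-]].
    by split=> //; have [GV G0] := GP x xU; apply: (unique x).
  by have [GV G0] := GP x xU.
- have xU : U xbar by apply: xbar_r.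
  have [GV G0] := GP xbar xU; apply: (unique xbar) => //; first exact: ybar_r.
  by rewrite -FE //; exact: ybar_r.
- by move=> x xU; have [GV G0] := GP x xU; rewrite FE.
Qed.
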